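(* Let $1\le k\le n$ be integers, let $\mathcal{J}\subset\binom{[n]}{k}$ be a maximal (by inclusion) arrangement of largest minors in $Gr^+(k,n)$, let $W\in\binom{[n]}{k}$ with $W\notin\mathcal{J}$, and let $t=cube_d(\mathcal{J},W)$. If $W$ is sorted with at least one element of $\mathcal{J}$, then $W$ is a $(\ge t+1,\mathcal{J})$-largest minor.
   Context: Notation: $[n]=\{1,\dots,n\}$ and $\binom{[n]}{k}$ is the set of $k$-element subsets of $[n]$. For a real $k\times n$ matrix $A$ of rank $k$ and $I\in\binom{[n]}{k}$, $\Delta_I(A)$ is the determinant of the $k\times k$ submatrix with column set $I$ (in increasing order). The positive Grassmannian $Gr^+(k,n)$ is the set of points of the real Grassmannian $Gr(k,n)$ (matrices modulo row operations) represented by matrices $A$ with $\Delta_I(A)>0$ for all $I$; equalities and inequalities between the $\Delta_I$ are taken for such representatives (they are defined up to a common positive factor). Arrangements: An arrangement of minors with $\mathcal{U}_0=\emptyset$ is an ordered set partition $\mathcal{U}=(\mathcal{U}_0,\mathcal{U}_1,\dots,\mathcal{U}_l)$ of $\binom{[n]}{k}$ with $\mathcal{U}_0=\emptyset$ and $\mathcal{U}_1,\dots,\mathcal{U}_l$ nonempty, for which there is a point of $Gr^+(k,n)$ with $\Delta_I=\Delta_J$ whenever $I,J$ lie in the same $\mathcal{U}_i$, and $\Delta_I<\Delta_J$ whenever $I\in\mathcal{U}_i$, $J\in\mathcal{U}_j$ with $i<j$. A set $\mathcal{J}$ is an arrangement of largest minors if there is such an arrangement $\mathcal{U}$ with $\mathcal{U}_l=\mathcal{J}$.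 $W\in\binom{[n]}{k}$ is a $(\ge t,\mathcal{J})$-largest minor if for every such arrangement $\mathcal{U}$ with $\mathcal{U}_l=\mathcal{J}$ one has $W\notin\mathcal{U}_l,\mathcal{U}_{l-1},\dots,\mathcal{U}_{l-t+2}$ (sets with negative index being regarded as empty). Sortedness: For $I,J\in\binom{[n]}{k}$ let $a_1\le\dots\le a_{2k}$ be the non-decreasing rearrangement of the multiset union of $I$ and $J$; put $Sort_1(I,J)=\{a_1,a_3,\dots,a_{2k-1}\}$, $Sort_2(I,J)=\{a_2,a_4,\dots,a_{2k}\}$. The pair $I,J$ is sorted if $\{I,J\}=\{Sort_1(I,J),Sort_2(I,J)\}$; a collection is sorted if every two of its elements are sorted. It is known that all inclusion-maximal sorted collections have exactly $n$ elements, and that arrangements of largest minors are exactly the nonempty sorted collections. Dual graph and cubical distance: $\Gamma_{(k,n)}$ is the graph whose vertices are the maximal sorted collections in $\binom{[n]}{k}$, two being adjacent iff they have exactly $n-1$ elements in common (this is the dual graph of Sturmfels' triangulation of the hypersimplex). A cube in $\Gamma_{(k,n)}$ is a subgraph isomorphic to the graph (1-skeleton) of an $m$-dimensional cube for some $m\ge1$ (an edge for $m=1$, a square for $m=2$, etc.). For maximal sorted collections $\mathcal{J}_1,\mathcal{J}_2$, $cube_d(\mathcal{J}_1,\mathcal{J}_2)=D$ if $D$ is the minimal number such that one can get from $\mathcal{J}_1$ to $\mathcal{J}_2$ by moving along $D$ cubes, i.e. there is a sequence $\mathcal{J}_1=\mathcal{I}_0,\mathcal{I}_1,\dots,\mathcal{I}_D=\mathcal{J}_2$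 of vertices with each consecutive pair lying on a common cube. For $W\in\binom{[n]}{k}$, $cube_d(\mathcal{J}_1,W)$ is the minimum of $cube_d(\mathcal{J}_1,\mathcal{J}_2)$ over all vertices $\mathcal{J}_2$ of $\Gamma_{(k,n)}$ with $W\in\mathcal{J}_2$. *)

(* Defs.v *)
From HB Require Import structures.
From mathcomp Require Import all_boot all_order all_algebra.
From mathcomp Require Import reals.

Set Implicit Arguments.
Unset Strict Implicit.
Unset Printing Implicit Defensive.

Import Order.TTheory GRing.Theory Num.Theory.

Local Open Scope ring_scope.

(* The ground set [n] = {1, .., n} is 'I_n = {0, .., n - 1}. *)
Definition ksubsets (k n : nat) : {set {set 'I_n}} :=
  [set I : {set 'I_n} | #|I| == k].

(* Only meaningful for #|I| = k; [enum I] lists I in increasing order. *)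
Definition Delta (R : realType) (k n : nat) (A : 'M[R]_(k, n))
    (I : {set 'I_n}) : R :=
  \det (\matrix_(i < k, j < k) nth 0 [seq A i c | c <- enum I] j).

(* A represents a point of the positive Grassmannian. *)
Definition Gr_pos (R : realType) (k n : nat) (A : 'M[R]_(k, n)) : Prop :=
  \rank A = k /\ forall I, I \in ksubsets k n -> 0 < Delta A I.

(* U = [:: U_0; U_1; ..; U_l] with U_0 empty. *)
Definition ordered_set_partition (k n : nat) (U : seq {set {set 'I_n}}) : Prop :=
  [/\ ohead U = Some set0,
      uniq (behead U)
    & partition [set B in behead U] (ksubsets k n)].

Definition arrangement (R : realType) (k n : nat) (U : seq {set {set 'I_n}}) :
    Prop :=
  ordered_set_partition k U /\
  exists2 A : 'M[R]_(k, n), Gr_pos A &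
    forall (i j : nat) (I J : {set 'I_n}),
      I \in nth set0 U i -> J \in nth set0 U j ->
      (i = j -> Delta A I = Delta A J) /\
      ((i < j)%N -> Delta A I < Delta A J).

Definition top_index (n : nat) (U : seq {set {set 'I_n}}) : nat := (size U).-1.

Definition arrangement_of_largest_minors (R : realType) (k n : nat)
    (J : {set {set 'I_n}}) : Prop :=
  exists2 U, arrangement R k U & nth set0 U (top_index U) = J.

Definition maximal_arrangement_of_largest_minors (R : realType) (k n : nat)
    (J : {set {set 'I_n}}) : Prop :=
  arrangement_of_largest_minors R k J /\
  forall J', arrangement_of_largest_minors R k J' -> J \subset J' -> J' = J.

(* The condition on i is l - t + 2 <= i <= l, with the subtraction moved to the
   other side because it is truncated on nat. *)
Definition ge_largest_minor (R : realType) (k n t : nat)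
    (J : {set {set 'I_n}}) (W : {set 'I_n}) : Prop :=
  forall U, arrangement R k U -> nth set0 U (top_index U) = J ->
  forall i : nat, (top_index U + 2 <= i + t)%N -> (i <= top_index U)%N ->
    W \notin nth set0 U i.

Definition merged (n : nat) (I J : {set 'I_n}) : seq 'I_n :=
  sort (fun x y : 'I_n => (x <= y)%N) (enum I ++ enum J).

(* a_1, a_3, .. are the entries of [merged I J] at even positions, as [onth]
   counts from 0. *)
Definition Sort1 (n : nat) (I J : {set 'I_n}) : {set 'I_n} :=
  [set x | [exists i : 'I_(size (merged I J)),
              ~~ odd i && (onth (merged I J) i == Some x)]].

Definition Sort2 (n : nat) (I J : {set 'I_n}) : {set 'I_n} :=
  [set x | [exists i : 'I_(size (merged I J)),
              odd i && (onth (merged I J) i == Some x)]].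

Definition sorted_pair (n : nat) (I J : {set 'I_n}) : bool :=
  [set I; J] == [set Sort1 I J; Sort2 I J].

Definition sorted_collection (k n : nat) (S : {set {set 'I_n}}) : bool :=
  (S \subset ksubsets k n) &&
  [forall I in S, forall J in S, sorted_pair I J].

(* The vertices of Gamma_(k, n). *)
Definition maximal_sorted (k n : nat) (S : {set {set 'I_n}}) : bool :=
  maxset (@sorted_collection k n) S.

Definition Gamma_adj (k n : nat) (S T : {set {set 'I_n}}) : bool :=
  [&& maximal_sorted k S, maximal_sorted k T, S != T & #|S :&: T| == n.-1].

Definition hypercube_adj (m : nat) (x y : {ffun 'I_m -> bool}) : bool :=
  #|[set i | x i != y i]| == 1%N.

(* (V, E) is a (not necessarily induced) subgraph of Gamma_(k, n) isomorphic to
   the 1-skeleton of the m-dimensional cube, for some m >= 1. *)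
Definition is_cube (k n : nat) (V : {set {set {set 'I_n}}})
    (E : rel {set {set 'I_n}}) : Prop :=
  [/\ forall S, S \in V -> maximal_sorted k S,
      forall S T, E S T -> [/\ S \in V, T \in V & Gamma_adj k S T]
    & exists (m : nat) (f : {ffun 'I_m -> bool} -> {set {set 'I_n}}),
        [/\ (1 <= m)%N, injective f, f @: [set: {ffun 'I_m -> bool}] = V
          & forall x y, E (f x) (f y) = hypercube_adj x y]].

Definition on_common_cube (k n : nat) (S T : {set {set 'I_n}}) : Prop :=
  exists (V : {set {set {set 'I_n}}}) (E : rel {set {set 'I_n}}),
    [/\ is_cube k V E, S \in V & T \in V].

Definition cube_walk (k n : nat) (S T : {set {set 'I_n}}) (D : nat) : Prop :=
  exists I_ : nat -> {set {set 'I_n}},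
    [/\ I_ 0%N = S, I_ D = T,
        forall i, (i <= D)%N -> maximal_sorted k (I_ i)
      & forall i, (i < D)%N -> on_common_cube k (I_ i) (I_ i.+1)].

Definition is_minimum (P : nat -> Prop) (d : nat) : Prop :=
  P d /\ forall d', P d' -> (d <= d')%N.

(* Distances are given by their graphs: [cube_d k S T D] reads
   cube_d(S, T) = D, and [cube_d_to k S W D] reads cube_d(S, W) = D. *)
Definition cube_d (k n : nat) (S T : {set {set 'I_n}}) (D : nat) : Prop :=
  is_minimum (cube_walk k S T) D.

Definition cube_d_to (k n : nat) (S : {set {set 'I_n}}) (W : {set 'I_n})
    (D : nat) : Prop :=
  is_minimum
    (fun d => exists T, [/\ maximal_sorted k T, W \in T & cube_d k S T d]) D.

(* Main.v *)
(* Fix I in J sorted with W.  The k-subsets sorted with I are obtained from I by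
   moving, for every x in an order ideal Q of a cyclic zigzag poset on [n], one
   ball from x to x + 1 (mod n); two of them are sorted iff their ideals are
   comparable, so the maximal sorted collections containing I are the complete
   flags P_0 < P_1 < .. < P_n of ideals.

   The three-term Pluecker relation makes log Delta strictly supermodular on this
   lattice of ideals.  As Delta is constant and maximal on the flag P of J, an
   ideal Q incomparable with P_p can be moved one element closer to P_p with a
   strict increase of its minor, so that at least |P_p (+) Q| - 1 levels of the
   arrangement lie above Q.

   Conversely, write the flag as a sequence of 0's and 1's recording which steps
   add an element of Q.  Swapping all the factors 01 at once moves the flag along
   one cube and lowers max_p |P_p (+) Q|; hence max_p |P_p (+) Q| - 1 cubes lead
   from J to a collection containing W. *)
Require Import Defs.
From HB Require Import structures.
From mathcomp Require Import all_boot all_order all_algebra.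
From mathcomp Require Import reals.
From mathcomp Require Import perm boolp zify ring.

Set Implicit Arguments.
Unset Strict Implicit.
Unset Printing Implicit Defensive.

Import Order.TTheory GRing.Theory Num.Theory.

(** * The three-term Pluecker relation *)

(** Columns come as a list, so that they can be permuted and signs tracked; [Delta A I] is the
    determinant for [s := enum I]. *)
Definition colsmx (F : fieldType) (k n : nat) (A : 'M[F]_(k, n))
    (s : seq 'I_n) : 'M[F]_k :=
  \matrix_(i < k, j < k) nth 0%R [seq A i c | c <- s] j.

Lemma colsmxE (F : fieldType) (k n : nat) (A : 'M[F]_(k, n)) (s : seq 'I_n) i j :
  colsmx A s i j = nth 0%R [seq A i c | c <- s] j.
Proof. by rewrite mxE. Qed.

Lemma det_colsmx_swap (F : fieldType) (k n : nat) (A : 'M[F]_(k, n))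
    (u v : seq 'I_n) (x y : 'I_n) : (size u).+1 < k ->
  (\det (colsmx A (u ++ x :: y :: v)) = - \det (colsmx A (u ++ y :: x :: v)))%R.
Proof.
move=> lt_u_k; have lt_u_k' := ltnW lt_u_k.
pose i1 := Ordinal lt_u_k'; pose i2 := Ordinal lt_u_k.
have -> : colsmx A (u ++ x :: y :: v) = xcol i1 i2 (colsmx A (u ++ y :: x :: v)).
  apply/matrixP=> i j; rewrite !mxE !map_cat !nth_cat !size_map /=.
  case: tpermP => [->|->|/eqP j1 /eqP j2] /=.
  - by rewrite ltnn subnn ltnNge leqnSn subSnn.
  - by rewrite ltnn subnn ltnNge leqnSn subSnn.
  - case: ltngtP => // [lt_u_j|eq_u_j]; last by case/eqP: j1; apply: val_inj.
    case def_d: (j - size u) => [|[|d]] //=; first by lia.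
    by case/eqP: j2; apply: val_inj => /=; lia.
rewrite xcolE det_mulmx det_perm odd_tperm.
have -> : i1 != i2 by rewrite -val_eqE /= neq_ltn leqnn.
by rewrite expr1 mulrN1.
Qed.

Lemma det_colsmx_move (F : fieldType) (k n : nat) (A : 'M[F]_(k, n))
    (u v w : seq 'I_n) (x : 'I_n) : size u + size v < k ->
  (\det (colsmx A (u ++ v ++ x :: w)) =
   (-1) ^+ size v * \det (colsmx A (u ++ x :: v ++ w)))%R.
Proof.
elim: v u => [|y v IHv] u /= lt_k; first by rewrite mul1r.
rewrite -cat_rcons IHv ?size_rcons ?addSnnS // cat_rcons.
by rewrite det_colsmx_swap -?exprSr ?exprS ?mulrN ?mulN1r ?mulNr //; lia.
Qed.

(** The last [m] columns are unit vectors, so the matrix is block lower triangular with an identity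
    block and only the upper left 2 x 2 block contributes. *)
Lemma det_two_cols (F : fieldType) (m : nat) (M : 'M[F]_(2 + m)) :
  (forall i j, M i (rshift 2 j) = (i == rshift 2 j)%:R)%R ->
  (\det M = M (lshift m ord0) (lshift m ord0) * M (lshift m ord_max) (lshift m ord_max)
          - M (lshift m ord0) (lshift m ord_max) * M (lshift m ord_max) (lshift m ord0))%R.
Proof.
move=> Mdelta; rewrite -[M in LHS]submxK.
have -> : ursubmx M = 0%R.
  by apply/matrixP=> i j; rewrite !mxE Mdelta eq_lrshift.
have -> : drsubmx M = 1%:M%R.
  by apply/matrixP=> i j; rewrite !mxE Mdelta (inj_eq (@rshift_inj _ _)).
rewrite det_lblock det1 mulr1 (expand_det_row _ ord0) !big_ord_recl big_ord0.
rewrite /cofactor !det_mx11 !mxE /= addr0 expr0 expr1 mul1r mulN1r mulrN.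
have -> : lift ord0 ord0 = ord_max :> 'I_2 by apply: val_inj.
by have -> : lift ord_max ord0 = ord0 :> 'I_2 by apply: val_inj.
Qed.

(** Multiplying by the inverse of the submatrix on p, q, s turns these columns into the identity.
    Each minor is then a common factor times a 2 x 2 determinant in the first two rows, and the
    relation becomes a polynomial identity. *)
Lemma plucker_three_term (F : fieldType) (m n : nat) (A : 'M[F]_(m.+2, n))
    (s : seq 'I_n) (p q r t : 'I_n) : size s = m ->
  (\det (colsmx A [:: p, q & s]) != 0)%R ->
  (\det (colsmx A [:: p, r & s]) * \det (colsmx A [:: q, t & s]) =
   \det (colsmx A [:: p, q & s]) * \det (colsmx A [:: r, t & s]) +
   \det (colsmx A [:: p, t & s]) * \det (colsmx A [:: q, r & s]))%R.
Proof.
move=> size_s nz_pq; set B := colsmx A [:: p, q & s].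
have unitB : B \in unitmx by rewrite unitmxE unitfE.
pose A' := (invmx B *m A)%R.
have colsA' l : size l = m.+2 -> colsmx A l = (B *m colsmx A' l)%R.
  move=> size_l; suff -> : colsmx A' l = (invmx B *m colsmx A l)%R by rewrite mulKVmx.
  apply/matrixP=> i j; rewrite !mxE (nth_map p) ?size_l // mxE.
  by apply: eq_bigr => h _; rewrite mxE (nth_map p) ?size_l.
have A'pq : (colsmx A' [:: p, q & s] = 1%:M)%R.
  by rewrite -[LHS](mulKmx unitB) -colsA' /= ?size_s // mulVmx.
have A'B (i j : 'I_m.+2) : (nth 0 [seq A' i c | c <- [:: p, q & s]] j = (i == j)%:R)%R.
  by rewrite -colsmxE A'pq mxE.
move: A' colsA' {A'pq} A'B => A' colsA' A'B.
pose i0 : 'I_m.+2 := ord0; pose i1 : 'I_m.+2 := lift ord0 ord0.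
have detE x y : (\det (colsmx A [:: x, y & s]) =
    \det B * (A' i0 x * A' i1 y - A' i0 y * A' i1 x))%R.
  rewrite colsA' /= ?size_s // det_mulmx; congr (_ * _)%R.
  have e0 : lshift m (ord0 : 'I_2) = i0 :> 'I_(2 + m) by apply: val_inj.
  have e1 : lshift m (ord_max : 'I_2) = i1 :> 'I_(2 + m) by apply: val_inj.
  rewrite (@det_two_cols F m) => [|i j]; first by rewrite e0 e1 !colsmxE.
  by rewrite colsmxE; apply: (A'B i (rshift 2 j)).
have p0 : A' i0 p = 1%R by rewrite [LHS](A'B i0 i0).
have p1 : A' i1 p = 0%R by rewrite [LHS](A'B i1 i0).
have q0 : A' i0 q = 0%R by rewrite [LHS](A'B i0 i1).
have q1 : A' i1 q = 1%R by rewrite [LHS](A'B i1 i1).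
rewrite (detE p r) (detE q t) (detE r t) (detE p t) (detE q r) p0 p1 q0 q1.
by move: (A' i0 r) (A' i1 r) (A' i0 t) (A' i1 t) (\det B)%R => a b c d e; ring.
Qed.

(** * Increasing enumerations and the signs of minors *)

Definition ord_lt (n : nat) : rel 'I_n := fun x y => (x < y)%N.
Arguments ord_lt {n} x y /.

Lemma ord_lt_trans (n : nat) : transitive (@ord_lt n).
Proof. by move=> y x z /=; apply: ltn_trans. Qed.

Lemma sorted_ord_lt (n : nat) (s : seq 'I_n) : sorted ord_lt s = pairwise ord_lt s.
Proof. exact: sorted_pairwise (@ord_lt_trans n) s. Qed.

Lemma sorted_enum_ord (n : nat) (S : {set 'I_n}) : sorted ord_lt (enum S).
Proof.
rewrite {1}/enum_mem; apply: sorted_filter; first exact: ord_lt_trans.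
rewrite -enumT; have := iota_ltn_sorted 0 n; rewrite -val_enum_ord.
by rewrite sorted_map.
Qed.

Lemma enum_ord_unique (n : nat) (S : {set 'I_n}) (s : seq 'I_n) :
  sorted ord_lt s -> s =i S -> enum S = s.
Proof.
move=> sorted_s eq_s; apply: (irr_sorted_eq (@ord_lt_trans n)) => //.
- by move=> x /=; rewrite ltnn.
- exact: sorted_enum_ord.
- by move=> x; rewrite mem_enum eq_s.
Qed.

Lemma enum_ord_setU1 (n : nat) (S : {set 'I_n}) (x : 'I_n) : x \notin S ->
  exists u v, [/\ enum S = u ++ v, enum (x |: S) = u ++ x :: v
                & size u = #|[set y in S | y < x]|].
Proof.
move=> Sx; have sortedS := sorted_enum_ord S.
pose u := [seq y : 'I_n <- enum S | y < x]; pose v := [seq y : 'I_n <- enum S | x < y].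
have mem_u y : (y \in u) = (y < x) && (y \in S) by rewrite mem_filter mem_enum.
have mem_v y : (y \in v) = (x < y) && (y \in S) by rewrite mem_filter mem_enum.
have sorted_u : pairwise ord_lt u.
  by rewrite -sorted_ord_lt; apply: sorted_filter => //; apply: ord_lt_trans.
have sorted_v : pairwise ord_lt v.
  by rewrite -sorted_ord_lt; apply: sorted_filter => //; apply: ord_lt_trans.
exists u, v; split; first 1 last.
- apply: enum_ord_unique => [|y].
    rewrite sorted_ord_lt pairwise_cat /= sorted_u sorted_v andbT andTb; apply/andP; split.
      apply/allrelP=> y z; rewrite inE mem_u mem_v => /andP[yx _].
      by case/predU1P=> [->|/andP[xz _]] //=; apply: ltn_trans xz.
    by apply/allP=> z; rewrite mem_v => /andP[].
  rewrite mem_cat in_cons in_setU1 mem_u mem_v -val_eqE.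
  by case: ltngtP => //=; rewrite ?orbF.
- rewrite cardE; congr size; apply/esym/enum_ord_unique => [|y].
    by apply: sorted_filter => //; apply: ord_lt_trans.
  by rewrite mem_u inE andbC.
apply: enum_ord_unique => [|y].
  rewrite sorted_ord_lt pairwise_cat sorted_u sorted_v !andbT.
  by apply/allrelP=> y z; rewrite mem_u mem_v => /andP[yx _] /andP[xz _] /=; apply: ltn_trans xz.
rewrite mem_cat mem_u mem_v.
by case: ltngtP => //= [|/val_inj->]; rewrite ?orbF // (negPf Sx).
Qed.

(** The height of the lattice path of [S] after [x] steps; [x] is a natural number so that [x = n]
    is allowed. *)
Definition below (n : nat) (S : {set 'I_n}) (x : nat) := #|[set y in S | y < x]|.

(** Moving the columns [y] and [x] from the front to their places passes exactly the elements of [S]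
    below each; as x < y they never cross each other. *)
Lemma Delta_setU2 (R : realType) (k n : nat) (A : 'M[R]_(k, n)) (S : {set 'I_n})
    (x y : 'I_n) : x < y -> x \notin S -> y \notin S -> #|S|.+1 < k ->
  (Delta A (x |: (y |: S)) =
   (-1) ^+ (below S x + below S y) * \det (colsmx A [:: x, y & enum S]))%R.
Proof.
move=> lt_xy Sx Sy ltk.
have Syx : x \notin y |: S by rewrite !inE negb_or Sx andbT -val_eqE neq_ltn lt_xy.
have [u [v [enumS enumyS size_u]]] := enum_ord_setU1 Sy.
have [a [b [enumyS' enumxyS size_a]]] := enum_ord_setU1 Syx.
have size_S : size (enum S) = #|S| by rewrite cardE.
have size_yS : size (enum (y |: S)) = #|S|.+1 by rewrite -cardE cardsU1 Sy.
rewrite /Delta -/(colsmx A _) enumxyS (det_colsmx_move A (u := [::])) /=; last first.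
  by apply: leq_ltn_trans ltk; rewrite -size_yS enumyS' size_cat leq_addr.
rewrite -enumyS' enumyS (det_colsmx_move A (u := [:: x])) /=; last first.
  by apply: leq_ltn_trans ltk; rewrite add1n -size_S enumS size_cat ltnS leq_addr.
rewrite -enumS mulrA -exprD; congr (_ ^+ (_ + _) * _)%R => //.
rewrite size_a; apply: eq_card => z; rewrite !inE.
by case: eqP => //= ->; rewrite ltnNge ltnW //= andbF.
Qed.

(** The two smaller products are the summands of the Pluecker relation, and both are positive. *)
Lemma Delta_crossing (R : realType) (k n : nat) (A : 'M[R]_(k, n)) (S : {set 'I_n})
    (p q r t : 'I_n) :
  Gr_pos A -> #|S|.+2 = k -> p < q -> q < r -> r < t ->
  p \notin S -> q \notin S -> r \notin S -> t \notin S ->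
  let D x y := Delta A (x |: (y |: S)) in
  (D p q * D r t < D p r * D q t /\ D p t * D q r < D p r * D q t)%R.
Proof.
move=> [_ posA] defk; case: k / defk in A posA *.
move=> pq qr rt Sp Sq Sr St D.
have pr := ltn_trans pq qr; have qt := ltn_trans qr rt.
have pt := ltn_trans pr rt.
have D_gt0 (x y : 'I_n) : x < y -> x \notin S -> y \notin S -> (0 < D x y)%R.
  move=> lt_xy Sx Sy; apply: posA; rewrite inE !cardsU1 !inE Sy negb_or Sx.
  by rewrite -val_eqE neq_ltn lt_xy.
suff -> : (D p r * D q t = D p q * D r t + D p t * D q r)%R.
  by rewrite ltrDl ltrDr !mulr_gt0 ?D_gt0.
have := D_gt0 _ _ pq Sp Sq; rewrite /D !Delta_setU2 // => /lt0r_neq0.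
rewrite mulf_eq0 negb_or => /andP[_ /plucker_three_term-/(_ r t)].
rewrite -cardE => /(_ erefl) pluck.
move: pluck; do 6![move: (\det _)%R => ?] => pluck.
move: (below S p) (below S q) (below S r) (below S t) => a b c d.
(* All three products carry the same sign, with exponent the sum of [below S] over p, q, r and t. *)
rewrite mulrACA pluck !exprD.
by do 4![move: (_ ^+ _)%R => ?]; ring.
Qed.

(** * Sorted pairs and interlacing *)

Lemma below0 (n : nat) (S : {set 'I_n}) : below S 0 = 0.
Proof. by apply: eq_card0 => y; rewrite !inE ltn0 andbF. Qed.

Lemma belowS (n : nat) (S : {set 'I_n}) (x : 'I_n) :
  below S x.+1 = below S x + (x \in S).
Proof.
rewrite /below (cardsD1 x) !inE ltnSn andbT addnC; congr (_ + _).
apply: eq_card => y; rewrite !inE ltnS [y <= x]leq_eqVlt -val_eqE /=.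
by case: ltngtP => //=; rewrite andbF.
Qed.

Lemma below_all (n : nat) (S : {set 'I_n}) : below S n = #|S|.
Proof. by apply: eq_card => y; rewrite !inE ltn_ord andbT. Qed.

Lemma nth_sorted_lt (n : nat) (s : seq 'I_n) (x0 : 'I_n) (p x : nat) :
  sorted (fun y z : 'I_n => y <= z) s -> p < size s ->
  (nth x0 s p < x) = (p < count (fun y : 'I_n => y < x) s).
Proof.
elim: s p => [|a s IHs] [|p] //=.
  move=> path_s _; case: ltnP => //= le_x_a; apply/esym/negP.
  rewrite add0n -has_count => /hasP[y].
  have /allP all_s : all (fun z : 'I_n => a <= z) s.
    by apply: order_path_min path_s => y1 y2 y3; apply: leq_trans.
  by move=> /all_s le_a_y; rewrite ltnNge (leq_trans le_x_a).
rewrite ltnS => path_s lt_p; have sorted_s := path_sorted path_s.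
rewrite (IHs p sorted_s lt_p); case: (ltnP a x) => [_|le_x_a]; first by rewrite add1n ltnS.
suff -> : count (fun y : 'I_n => y < x) s = 0 by [].
apply/eqP; rewrite -leqn0 leqNgt -has_count; apply/hasP => -[y].
have /allP all_s : all (fun z : 'I_n => a <= z) s.
  by apply: order_path_min path_s => y1 y2 y3; apply: leq_trans.
by move=> /all_s le_a_y; rewrite ltnNge (leq_trans le_x_a).
Qed.

Lemma count_merged (n : nat) (I J : {set 'I_n}) (x : nat) :
  count (fun y : 'I_n => y < x) (merged I J) = below I x + below J x.
Proof.
have countE (S : {set 'I_n}) : count (fun y : 'I_n => y < x) (enum S) = below S x.
  rewrite -size_filter [RHS]cardE; apply/perm_size/uniq_perm => [||y].
  - by rewrite filter_uniq // enum_uniq.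
  - exact: enum_uniq.
  - by rewrite mem_filter !mem_enum inE andbC.
by rewrite count_sort count_cat !countE.
Qed.

(** The list is sorted, so the copies of [x] fill consecutive positions, right after the entries
    below [x]. *)
Lemma onth_merged (n : nat) (I J : {set 'I_n}) (x : 'I_n) (p : nat) :
  let c := below I x + below J x in
  (onth (merged I J) p == Some x) = (c <= p < c + ((x \in I) + (x \in J))).
Proof.
rewrite /= addnACA -!belowS -!count_merged leqNgt; set s := merged I J.
have sorted_s : sorted (fun y z : 'I_n => y <= z) s.
  by apply: sort_sorted => y z; apply: leq_total.
have [lt_p|le_p] := ltnP p (size s).
  rewrite onthE (nth_map x) // (inj_eq (@Some_inj _)) -!(nth_sorted_lt x) //.
  by rewrite ltnS -leqNgt -eqn_leq eq_sym.
rewrite onth_default //; apply/esym/negbTE/negP => /andP[_].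
by rewrite ltnNge (leq_trans (count_size _ _) le_p).
Qed.

(** Two copies of [x] meet both parities; a single copy sits at position [below I x + below J x]. *)
Lemma exists_onth_merged (n : nat) (par : pred nat) (I J : {set 'I_n}) (x : 'I_n) :
  (forall c, par c.+1 = ~~ par c) ->
  [exists i : 'I_(size (merged I J)), par i && (onth (merged I J) i == Some x)] =
  (x \in I) && (x \in J) ||
  ((x \in I) || (x \in J)) && par (below I x + below J x).
Proof.
move=> parS; set c := below I x + below J x.
have le_size : c + ((x \in I) + (x \in J)) <= size (merged I J).
  by rewrite addnACA -!belowS -count_merged count_size.
apply/existsP/idP => [[p]|].
  rewrite onth_merged -/c.
  by case: (x \in I) (x \in J) => [] [] //=; rewrite ?addn0 ?addn1 ?ltnS -?eqn_leq;
     [case/andP=> ? /eqP-> | case/andP=> ? /eqP-> | case: ltngtP; rewrite ?andbF].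
have pos p : par p -> c <= p < c + ((x \in I) + (x \in J)) ->
    exists i : 'I_(size (merged I J)), par i && (onth (merged I J) i == Some x).
  move=> par_p p_in; have /andP[_ /leq_trans/(_ le_size) lt_p] := p_in.
  by exists (Ordinal lt_p); rewrite /= par_p onth_merged.
have [/pos p_c|par_c] := boolP (par c).
  rewrite andbT => xIJ; apply: p_c.
  by case: (x \in I) (x \in J) xIJ => [] [] //= _; rewrite leqnn /= -[X in X < _]addn0 ltn_add2l.
rewrite andbF orbF => /andP[xI xJ]; apply: (pos c.+1); first by rewrite parS.
by rewrite xI xJ addn2 leqnSn ltnSn.
Qed.

Lemma mem_Sort1 (n : nat) (I J : {set 'I_n}) (x : 'I_n) :
  (x \in Sort1 I J) =
  (x \in I) && (x \in J) ||
  ((x \in I) || (x \in J)) && ~~ odd (below I x + below J x).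
Proof. by rewrite inE (@exists_onth_merged n (fun i => ~~ odd i)). Qed.

Lemma mem_Sort2 (n : nat) (I J : {set 'I_n}) (x : 'I_n) :
  (x \in Sort2 I J) =
  (x \in I) && (x \in J) ||
  ((x \in I) || (x \in J)) && odd (below I x + below J x).
Proof. by rewrite inE exists_onth_merged. Qed.

(** In terms of increasing entries: i_1 <= j_1 <= i_2 <= j_2 <= ..., written with heights of lattice
    paths. *)
Definition interlaced (n : nat) (I J : {set 'I_n}) :=
  forall x, x <= n -> below J x <= below I x <= (below J x).+1.

Lemma interlaced_Sort (n : nat) (I J : {set 'I_n}) :
  interlaced I J <-> I = Sort1 I J /\ J = Sort2 I J.
Proof.
split=> [lace|[eq_I eq_J]].
  split; apply/setP => x; rewrite (mem_Sort1, mem_Sort2);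
  have := lace x (ltnW (ltn_ord x)); have := lace x.+1 (ltn_ord x);
  by rewrite !belowS; case: (x \in I) (x \in J) => [] [] //=; lia.
(* The height difference, 0 or 1, is the parity of the sum of the heights. A point of exactly one
   set lies in [I] if it is 0 and in [J] if it is 1, so it stays in {0, 1}. *)
elim=> [|x IHx] lt_x; first by rewrite !below0.
have := IHx (ltnW lt_x); pose y := Ordinal lt_x.
have := congr1 (fun S : {set 'I_n} => y \in S) eq_J.
have := congr1 (fun S : {set 'I_n} => y \in S) eq_I.
have := belowS I y; have := belowS J y; rewrite mem_Sort1 mem_Sort2 /= => -> ->.
by case: (y \in I) (y \in J) => [] [] //=; lia.
Qed.

Lemma merged_sym (n : nat) (I J : {set 'I_n}) : merged I J = merged J I.
Proof.
apply/perm_sort_inP; last by rewrite perm_catC.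
- by move=> x y _ _; apply: leq_total.
- by move=> y x z _ _ _; apply: leq_trans.
- by move=> x y _ _ /andP[xy yx]; apply/val_inj/eqP; rewrite eqn_leq xy.
Qed.

Lemma sorted_pairP (n : nat) (I J : {set 'I_n}) :
  reflect (interlaced I J \/ interlaced J I) (sorted_pair I J).
Proof.
have e1 : Sort1 J I = Sort1 I J by rewrite /Sort1 merged_sym.
have e2 : Sort2 J I = Sort2 I J by rewrite /Sort2 merged_sym.
apply: (iffP eqP) => [eqIJ|[] /interlaced_Sort[eqI eqJ]]; first 1 last.
- by rewrite -eqI -eqJ.
- by rewrite -e1 -e2 -eqI -eqJ setUC.
suff: I = Sort1 I J /\ J = Sort2 I J \/ J = Sort1 I J /\ I = Sort2 I J.
  by case=> eqs; [left|right]; apply/interlaced_Sort; rewrite ?e1 ?e2.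
move: (Sort1 I J) (Sort2 I J) eqIJ => S1 S2 eqIJ.
have := set21 I J; have := set22 I J; rewrite {1 2}eqIJ !in_set2.
have := set21 S1 S2; have := set22 S1 S2; rewrite -{1 2}eqIJ !in_set2.
move=> /orP[]/eqP a /orP[]/eqP b /orP[]/eqP c /orP[]/eqP d;
by first [left; split; congruence | right; split; congruence].
Qed.

(** * Ideals and the sets sorted with I *)

Ltac lia_mem :=
  repeat match goal with |- context [nat_of_bool (in_mem ?x ?A)] =>
    move: (in_mem x A) => ? end; lia.

(* The order ideals of the poset on [n] in which, for every i, i precedes its cyclic
   predecessor if i is in I and follows it otherwise. *)
Definition ideal (n : nat) (I Q : {set 'I_n}) : bool :=
  [forall i, (i \in Q) <= (i \in I) + (ord_pred i \in Q) <= (i \in Q).+1].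

(* For an ideal Q, the indicator function of shift I Q is
   [i in I] + [i - 1 in Q] - [i in Q]: one ball moves from x to x + 1 for each x in Q. *)
Definition shift (n : nat) (I Q : {set 'I_n}) : {set 'I_n} :=
  [set i | (i \in Q) < (i \in I) + (ord_pred i \in Q)].

Lemma shiftE (n : nat) (I Q : {set 'I_n}) (i : 'I_n) : ideal I Q ->
  (i \in shift I Q) + (i \in Q) = (i \in I) + (ord_pred i \in Q).
Proof.
move/forallP/(_ i); rewrite inE.
by case: (i \in Q) (i \in I) (ord_pred i \in Q) => [] [] [].
Qed.

Lemma ideal_shiftP (n : nat) (I Q W : {set 'I_n}) :
  (forall i, (i \in W) + (i \in Q) = (i \in I) + (ord_pred i \in Q)) ->
  ideal I Q /\ W = shift I Q.
Proof.
move=> eqW; split; first apply/forallP=> i.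
  by have := eqW i; case: (i \in W) (i \in Q) (i \in I) (ord_pred i \in Q) => [] [] [] [].
apply/setP=> i; rewrite inE; have := eqW i.
by case: (i \in W) (i \in Q) (i \in I) (ord_pred i \in Q) => [] [] [] [].
Qed.

Lemma ideal0 (n : nat) (I : {set 'I_n}) : ideal I set0.
Proof. by apply/forallP=> i; rewrite !inE; case: (i \in I). Qed.

Lemma idealT (n : nat) (I : {set 'I_n}) : ideal I setT.
Proof. by apply/forallP=> i; rewrite !inE; case: (i \in I). Qed.

Lemma shift0 (n : nat) (I : {set 'I_n}) : shift I set0 = I.
Proof. by apply/setP=> i; rewrite !inE; case: (i \in I). Qed.

Lemma shiftT (n : nat) (I : {set 'I_n}) : shift I setT = I.
Proof. by apply/setP=> i; rewrite !inE; case: (i \in I). Qed.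

Lemma idealU (n : nat) (I P Q : {set 'I_n}) :
  ideal I P -> ideal I Q -> ideal I (P :|: Q).
Proof.
move=> /forallP idP /forallP idQ; apply/forallP=> i; move: (idP i) (idQ i).
rewrite !inE; case: (i \in I); case: (i \in P) (ord_pred i \in P) => [] [] //;
by case: (i \in Q) (ord_pred i \in Q) => [] [].
Qed.

Lemma idealI (n : nat) (I P Q : {set 'I_n}) :
  ideal I P -> ideal I Q -> ideal I (P :&: Q).
Proof.
move=> /forallP idP /forallP idQ; apply/forallP=> i; move: (idP i) (idQ i).
rewrite !inE; case: (i \in I); case: (i \in P) (ord_pred i \in P) => [] [] //;
by case: (i \in Q) (ord_pred i \in Q) => [] [].
Qed.

Lemma ord_predS (n x : nat) (lt_x : x < n.+1) (lt_Sx : x.+1 < n.+1) :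
  ord_pred (Ordinal lt_Sx) = Ordinal lt_x.
Proof. by apply: val_inj; rewrite /= modnDr modn_small. Qed.

Lemma ord_pred0 (n : nat) (lt0n : 0 < n.+1) : ord_pred (Ordinal lt0n) = ord_max.
Proof. by apply: val_inj; rewrite /= modn_small. Qed.

(** The balance [shiftE] telescopes over the positions up to [i]; the boundary term is the ball
    arriving cyclically from [ord_max]. *)
Lemma below_shift (n : nat) (I Q : {set 'I_n.+1}) (i : 'I_n.+1) : ideal I Q ->
  below (shift I Q) i.+1 + (i \in Q) = below I i.+1 + (ord_max \in Q).
Proof.
move=> idQ; case: i; elim=> [|x IHx] lt_x.
  by rewrite !belowS !below0 (shiftE _ idQ) ord_pred0.
have lt_x' := ltnW lt_x; have := IHx lt_x'; have := shiftE (Ordinal lt_x) idQ.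
by rewrite (ord_predS lt_x') !(belowS _ (Ordinal lt_x)) /=; lia_mem.
Qed.

Lemma card_shift (n : nat) (I Q : {set 'I_n.+1}) : ideal I Q -> #|shift I Q| = #|I|.
Proof.
move=> idQ; have /addIn := below_shift ord_max idQ.
by rewrite -(below_all I) -(below_all (shift I Q)).
Qed.

Lemma interlaced_shift (n : nat) (I P Q : {set 'I_n.+1}) : ideal I P -> ideal I Q ->
  interlaced (shift I P) (shift I Q) <->
  forall i, (i \in P) + (ord_max \in Q) <= (i \in Q) + (ord_max \in P)
            <= ((i \in P) + (ord_max \in Q)).+1.
Proof.
move=> idP idQ; split=> [lace i | leq_PQ [|x] lt_x]; last 1 first.
- have := below_shift (Ordinal lt_x) idP; have := below_shift (Ordinal lt_x) idQ.
  by have := leq_PQ (Ordinal lt_x); rewrite /=; lia_mem.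
- have := below_shift i idP; have := below_shift i idQ.
  by have := lace i.+1 (ltn_ord i); rewrite /=; lia_mem.
- by rewrite !below0.
Qed.

(** By [below_shift] the two paths differ by the difference of the indicators of [P] and [Q], up to
    a constant coming from [ord_max]. Whether [ord_max] separates [P] and [Q] decides which order of
    interlacing goes with which inclusion. *)
Lemma sorted_shift (n : nat) (I P Q : {set 'I_n.+1}) : ideal I P -> ideal I Q ->
  sorted_pair (shift I P) (shift I Q) = (P \subset Q) || (Q \subset P).
Proof.
move=> idP idQ; apply/sorted_pairP/orP => [[]|[] /subsetP sub].
- move/(interlaced_shift idP idQ) => le_PQ.
  case: (boolP ((ord_max \in P) && (ord_max \notin Q))) => max_PQ; [right|left];
  by apply/subsetP=> i; move: (le_PQ i) max_PQ;
     case: (ord_max \in P) (ord_max \in Q) (i \in P) (i \in Q) => [] [] [] [].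
- move/(interlaced_shift idQ idP) => le_PQ.
  case: (boolP ((ord_max \in Q) && (ord_max \notin P))) => max_PQ; [left|right];
  by apply/subsetP=> i; move: (le_PQ i) max_PQ;
     case: (ord_max \in P) (ord_max \in Q) (i \in P) (i \in Q) => [] [] [] [].
- case: (boolP ((ord_max \in P) == (ord_max \in Q))) => max_PQ; [left|right];
  apply/interlaced_shift => // i; move: (sub i) (sub ord_max) max_PQ;
  by case: (ord_max \in P) (ord_max \in Q) (i \in P) (i \in Q) => [] [] [] [] // h h' //; first [by have := h isT | by have := h' isT].
- case: (boolP ((ord_max \in P) == (ord_max \in Q))) => max_PQ; [right|left];
  apply/interlaced_shift => // i; move: (sub i) (sub ord_max) max_PQ;
  by case: (ord_max \in P) (ord_max \in Q) (i \in P) (i \in Q) => [] [] [] [] // h h' //; first [by have := h isT | by have := h' isT].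
Qed.

Lemma sorted_pair_shift (n : nat) (I W : {set 'I_n.+1}) :
  #|W| = #|I| -> sorted_pair W I -> exists2 Q, ideal I Q & W = shift I Q.
Proof.
rewrite -(below_all I) -(below_all W) => eqWI /sorted_pairP lace.
(* [c] is to be the indicator of [ord_max] in [Q]; the set [Q] is then forced by [below_shift]. *)
have [c lace_c] : exists c : nat, forall x, x <= n.+1 ->
    below W x <= below I x + c <= (below W x).+1.
  by case: lace => lace; [exists 1|exists 0] => x /lace; lia.
pose Q := [set i : 'I_n.+1 | below W i.+1 < below I i.+1 + c].
have inQ (i : 'I_n.+1) : below W i.+1 + (i \in Q) = below I i.+1 + c.
  by rewrite inE; have := lace_c i.+1 (ltn_ord i); case: ltnP => /=; lia_mem.
have [idQ defW] : ideal I Q /\ W = shift I Q; last by exists Q.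
apply: ideal_shiftP => -[[|x] lt_x].
  have := inQ (Ordinal lt_x); have := inQ ord_max; rewrite ord_pred0.
  by rewrite !(belowS _ (Ordinal lt_x)) !below0 /=; lia_mem.
have lt_x' := ltnW lt_x; have := inQ (Ordinal lt_x); have := inQ (Ordinal lt_x').
by rewrite (ord_predS lt_x') !(belowS _ (Ordinal lt_x)) /=; lia_mem.
Qed.

(* [setT] is excluded because shift I setT = shift I set0 = I. *)
Lemma shift_inj (n : nat) (I : {set 'I_n.+1}) :
  {in [pred Q | ideal I Q & Q != setT] &, injective (shift I)}.
Proof.
move=> P Q /andP[idP PT] /andP[idQ QT] eqPQ.
have eq_i (i : 'I_n.+1) : (i \in P) + (ord_max \in Q) = (i \in Q) + (ord_max \in P).
  by have := below_shift i idP; have := below_shift i idQ; rewrite eqPQ; lia_mem.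
case: (boolP ((ord_max \in P) == (ord_max \in Q))) => [/eqP eq_max|neq_max].
  by apply/setP=> i; have := eq_i i; rewrite eq_max; case: (i \in P) (i \in Q) (ord_max \in Q) => [] [] [].
case max_P: (ord_max \in P) neq_max eq_i => /= neq_max eq_i.
  case/eqP: PT; apply/setP=> i; move: (eq_i i) neq_max; rewrite inE.
  by case: (i \in P) (i \in Q) (ord_max \in Q) => [] [] [].
case/eqP: QT; apply/setP=> i; move: (eq_i i) neq_max; rewrite inE.
by case: (i \in P) (i \in Q) (ord_max \in Q) => [] [] [].
Qed.

(** * Supermodularity of the minors *)

(* Proportional to the distance between the lattice path of I and the straight line
   of slope #|I| / n, hence well defined modulo n; it increases strictly along the
   poset of [ideal] because 0 < #|I| < n. *)
Definition ideal_rank (n : nat) (I : {set 'I_n}) (i : 'I_n) : nat :=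
  #|I| * i.+1 + n * (#|I| - below I i.+1).

Lemma below_le (n : nat) (S : {set 'I_n}) (x : nat) : below S x <= #|S|.
Proof. by apply/subset_leq_card/subsetP=> y; rewrite inE => /andP[]. Qed.

(** Passing from the cyclic predecessor to [i] adds [#|I|] and, if [i] is in [I], subtracts [n.+1];
    this also holds across the wrap-around. *)
Lemma ideal_rank_pred (n : nat) (I : {set 'I_n.+1}) (i : 'I_n.+1) : 0 < #|I| <= n ->
  if i \in I then ideal_rank I i < ideal_rank I (ord_pred i)
  else ideal_rank I (ord_pred i) < ideal_rank I i.
Proof.
rewrite /ideal_rank; case: i => -[|x] lt_x /andP[I_gt0 I_le].
  rewrite ord_pred0 belowS below0 /= below_all subnn.
  by move: #|I| I_gt0 I_le => k; case: (_ \in I) => /=; nia.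
have lt_x' := ltnW lt_x; rewrite (ord_predS lt_x') (belowS _ (Ordinal lt_x)) /=.
have := below_le I x.+2; rewrite (belowS _ (Ordinal lt_x)) /=.
by move: #|I| (below I x.+1) I_gt0 I_le => k b; case: (_ \in I) => /=; nia.
Qed.

Lemma ord_pred_neq (n : nat) (x : 'I_n.+1) : 0 < n -> ord_pred x != x.
Proof.
rewrite -val_eqE => n_gt0; case: x => -[|x] lt_x; first by rewrite ord_pred0 -lt0n.
by rewrite (ord_predS (ltnW lt_x)) /= neq_ltn ltnSn.
Qed.

(** An element of [Q :\: P] of least rank works: its predecessors in the poset lie in [Q] and have
    smaller rank, hence lie in [P]. *)
Lemma ideal_extend (n : nat) (I P Q : {set 'I_n.+1}) : 0 < #|I| <= n ->
  ideal I P -> ideal I Q -> P \proper Q ->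
  exists y, [/\ y \in Q, y \notin P & ideal I (y |: P)].
Proof.
move=> cardI idP idQ /properP[/subsetP sub_PQ [y0 Qy0 Py0]].
have n_gt0 : 0 < n by case/andP: cardI => /leq_trans; apply.
have [|y /andP[Qy Py] min_y] :=
  @arg_minnP _ y0 [pred y | (y \in Q) && (y \notin P)] (ideal_rank I).
  by rewrite /= Qy0.
have in_P z : z \in Q -> ideal_rank I z < ideal_rank I y -> z \in P.
  move=> Qz lt_zy; apply/negPn/negP => Pz; move: lt_zy.
  by rewrite ltnNge min_y //= Qz.
exists y; split=> //; apply/forallP=> i; rewrite !in_setU1.
have := forallP idQ i; have := forallP idP i; have := ideal_rank_pred i cardI.
have neq_pi := ord_pred_neq i n_gt0.
have [eq_iy|neq_iy] := eqVneq i y; have [eq_py|neq_py] := eqVneq (ord_pred i) y => //=.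
- by rewrite eq_py eq_iy eqxx in neq_pi.
- rewrite eq_iy; case: (y \in I) => /=; first by move=> _ _ _; case: (ord_pred y \in P).
  move=> lt_rank _; rewrite Qy; case Qpy: (ord_pred y \in Q) => //.
  by rewrite (in_P _ Qpy lt_rank).
- rewrite eq_py Qy; case Ii: (i \in I); last by case: (i \in P).
  move=> lt_rank _; case Qi: (i \in Q) => //.
  by rewrite (in_P i Qi lt_rank).
Qed.

Lemma shift_setU1 (n : nat) (I Q : {set 'I_n.+1}) (x : 'I_n.+1) : 0 < n ->
  ideal I Q -> x \notin Q -> ideal I (x |: Q) ->
  [/\ x \in shift I Q, ordS x \notin shift I Q
    & shift I (x |: Q) = ordS x |: (shift I Q :\ x)].
Proof.
move=> n_gt0 idQ Qx idxQ; have neq_px := ord_pred_neq x n_gt0.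
have neq_sx : ordS x != x by have := ord_pred_neq (ordS x) n_gt0; rewrite ordSK eq_sym.
have x_in : x \in shift I Q.
  have := shiftE x idQ; have := shiftE x idxQ.
  rewrite !in_setU1 eqxx (negPf neq_px) (negPf Qx) /=.
  by case: (x \in shift I Q) (x \in I) (ord_pred x \in Q) (x \in shift I _) => [] [] [] [].
have sx_notin : ordS x \notin shift I Q.
  have := shiftE (ordS x) idQ; have := shiftE (ordS x) idxQ.
  rewrite !in_setU1 ordSK eqxx (negPf neq_sx) (negPf Qx) /=.
  by case: (ordS x \in shift I Q) (ordS x \in I) (ordS x \in Q) (ordS x \in shift I _) => [] [] [] [].
split=> //; apply/setP=> i; rewrite in_setU1 in_setD1.
have := shiftE i idQ; have := shiftE i idxQ; rewrite !in_setU1.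
have -> : (ord_pred i == x) = (i == ordS x).
  by apply/eqP/eqP => [<-|->]; rewrite ?ord_predK ?ordSK.
have [->|neq_is] := eqVneq i (ordS x).
  rewrite (negPf neq_sx) (negPf sx_notin) ordSK (negPf Qx) /=.
  by case: (_ \in I) (_ \in Q) (_ \in shift I _) => [] [] [].
have [->|neq_ix] := eqVneq i x.
  rewrite (negPf Qx) x_in /=.
  by case: (_ \in I) (_ \in Q) (_ \in shift I _) => [] [] [].
by rewrite /=; case: (i \in Q) (i \in I) (ord_pred i \in Q) (i \in shift I Q) (i \in shift I _) => [] [] [] [] [].
Qed.

(** The four sets share a common part [S], completed by two of the points x, x + 1, y, y + 1. The
    pairs {x, y} and {x + 1, y + 1} cross in the cyclic order, so [Delta_crossing] makes their
    product the larger one. *)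
Lemma Delta_shift_diamond (R : realType) (k n : nat) (A : 'M[R]_(k, n.+1))
    (I Q : {set 'I_n.+1}) (x y : 'I_n.+1) :
  Gr_pos A -> #|I| = k -> 0 < k <= n ->
  ideal I Q -> ideal I (x |: Q) -> ideal I (y |: Q) ->
  x \notin Q -> y \notin Q -> x != y ->
  (Delta A (shift I (x |: Q)) * Delta A (shift I (y |: Q)) <
   Delta A (shift I Q) * Delta A (shift I (x |: (y |: Q))))%R.
Proof.
move=> posA cardI k_bounds idQ idxQ idyQ.
wlog lt_xy : x y idxQ idyQ / x < y => [IH Qx Qy neq_xy|Qx Qy neq_xy].
  have := neq_xy; rewrite -val_eqE neq_ltn => /orP[lt_xy|lt_yx]; first exact: IH.
  by rewrite setUCA mulrC; apply: IH => //; rewrite eq_sym.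
have n_gt0 : 0 < n by case/andP: k_bounds => /leq_trans; apply.
have idxyQ : ideal I (x |: (y |: Q)).
  have -> : x |: (y |: Q) = (x |: Q) :|: (y |: Q) by rewrite setUACA setUid setUA.
  exact: idealU.
have [Vx Vsx defx] := shift_setU1 n_gt0 idQ Qx idxQ.
have [Vy Vsy defy] := shift_setU1 n_gt0 idQ Qy idyQ.
have xyQ : x \notin y |: Q by rewrite in_setU1 negb_or neq_xy.
have [_ _ defxy] := shift_setU1 n_gt0 idyQ xyQ idxyQ.
(* The successor of [x] is free in [shift I Q] while [y] is occupied, and symmetrically, so the four
   points are distinct. *)
have neq_sxy : ordS x != y by apply: contraNneq Vsx => ->.
have neq_syx : ordS y != x by apply: contraNneq Vsy => ->.
have neq_s : ordS x != ordS y by rewrite (inj_eq (@ordS_inj _)).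
rewrite defxy defx defy; set V := shift I Q in Vx Vsx Vy Vsy *.
pose S := V :\ x :\ y.
have [Sx Sy Ssx Ssy] : [/\ x \notin S, y \notin S, ordS x \notin S & ordS y \notin S].
  by rewrite !in_setD1 !eqxx (negPf Vsx) (negPf Vsy) !andbF.
have cardS : #|S|.+2 = k.
  rewrite -cardI -(card_shift idQ) -/V (cardsD1 x V) Vx (cardsD1 y (V :\ x)).
  by rewrite in_setD1 eq_sym neq_xy Vy.
have -> : V = x |: (y |: S) by rewrite /S setD1K ?setD1K // in_setD1 eq_sym neq_xy.
have -> : (x |: (y |: S)) :\ x = y |: S.
  by rewrite setU1K // in_setU1 negb_or neq_xy.
have -> : (x |: (y |: S)) :\ y = x |: S.
  by rewrite setUCA setU1K // in_setU1 negb_or eq_sym neq_xy.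
have -> : (ordS y |: (x |: S)) :\ x = ordS y |: S.
  by rewrite setUCA setU1K // in_setU1 negb_or eq_sym neq_syx.
have val_sx : val (ordS x) = x.+1 by rewrite /= modn_small // ltnS (leq_trans lt_xy) // -ltnS.
have lt_sxy : ordS x < y by rewrite ltn_neqAle val_eqE neq_sxy val_sx.
have lt_xsx : x < ordS x by rewrite val_sx.
have [lt_yn|le_ny] := ltnP y n.
  have lt_ysy : y < ordS y by rewrite /= modn_small.
  have [_] := Delta_crossing posA cardS lt_xsx lt_sxy lt_ysy Sx Ssx Sy Ssy.
  by rewrite mulrC [ordS y |: _]setUCA.
(* Here [ordS y] wraps to 0, the linear order becomes ordS y < x < ordS x < y, and the other
   inequality of [Delta_crossing] applies. *)
have val_sy : val (ordS y) = 0.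
  by rewrite /= (_ : y = n :> nat) ?modnn //; apply/eqP; rewrite eqn_leq le_ny -ltnS ltn_ord.
have lt_syx : ordS y < x by rewrite ltn_neqAle val_eqE neq_syx val_sy.
have [+ _] := Delta_crossing posA cardS lt_syx lt_xsx lt_sxy Ssy Sx Ssx Sy.
by rewrite mulrC [in X in (_ < X)%R -> _]mulrC [ordS x |: (ordS y |: S)]setUCA.
Qed.

Lemma Delta_shift_gt0 (R : realType) (k n : nat) (A : 'M[R]_(k, n.+1))
    (I Q : {set 'I_n.+1}) :
  Gr_pos A -> #|I| = k -> ideal I Q -> (0 < Delta A (shift I Q))%R.
Proof. by case=> _ posA cardI idQ; apply: posA; rewrite inE card_shift // cardI. Qed.

Lemma ltr_cross_trans (R : realFieldType) (a b c d e f : R) :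
  (0 < b -> 0 < d -> 0 < e -> 0 < c ->
   a * b < c * d -> d * e < b * f -> a * e < c * f)%R.
Proof.
move=> b0 d0 e0 c0 lt1 lt2; rewrite -(ltr_pM2r (mulr_gt0 b0 d0)).
have lt1' : (a * b * (d * e) < c * d * (d * e))%R by rewrite ltr_pM2r ?mulr_gt0.
have lt2' : (c * d * (d * e) < c * d * (b * f))%R by rewrite ltr_pM2l ?mulr_gt0.
have -> : (a * e * (b * d) = a * b * (d * e))%R by ring.
have -> : (c * f * (b * d) = c * d * (b * f))%R by ring.
exact: lt_trans lt1' lt2'.
Qed.

(* The ratio Delta (x |: Q) / Delta Q increases along a saturated chain of ideals
   from P to Q. *)
Lemma Delta_shift_supermodular (R : realType) (k n : nat) (A : 'M[R]_(k, n.+1))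
    (I P Q : {set 'I_n.+1}) (x : 'I_n.+1) :
  Gr_pos A -> #|I| = k -> 0 < k <= n ->
  ideal I P -> ideal I Q -> ideal I (x |: P) -> x \notin Q -> P \proper Q ->
  (Delta A (shift I (x |: P)) * Delta A (shift I Q) <
   Delta A (shift I P) * Delta A (shift I (x |: Q)))%R.
Proof.
move=> posA cardI k_bounds idP idQ idxP Qx.
have gt0 := Delta_shift_gt0 posA cardI.
have [m] := ubnP #|Q :\: P|; elim: m => // m IHm in P idP idxP * => le_m sub_PQ.
have [|y [Qy Py idyP]] := ideal_extend _ idP idQ sub_PQ; first by rewrite cardI.
have neq_xy : x != y by apply: contraNneq Qx => ->.
have Px : x \notin P by apply: contra Qx; apply/subsetP/proper_sub.
have lt_diamond := Delta_shift_diamond posA cardI k_bounds idP idxP idyP Px Py neq_xy.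
have sub_yPQ : y |: P \subset Q by rewrite subUset sub1set Qy proper_sub.
have [eq_yPQ|neq_yPQ] := eqVneq (y |: P) Q; first by rewrite -eq_yPQ.
have idxyP : ideal I (x |: (y |: P)).
  have -> : x |: (y |: P) = (x |: P) :|: (y |: P) by rewrite setUACA setUid setUA.
  exact: idealU.
have lt_IH : (Delta A (shift I (x |: (y |: P))) * Delta A (shift I Q) <
    Delta A (shift I (y |: P)) * Delta A (shift I (x |: Q)))%R.
  apply: IHm => //; last by rewrite properEneq neq_yPQ.
  rewrite -ltnS; apply: leq_trans le_m; rewrite ltnS; apply: proper_card.
  apply/properP; split; first by apply: setDS; apply: subsetUr.
  by exists y; rewrite !inE ?eqxx ?Qy ?Py.
(* Multiplying the diamond at [P] by the induction hypothesis at [y |: P] cancels the two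
   intermediate minors. *)
by apply: ltr_cross_trans lt_diamond lt_IH; rewrite ?gt0.
Qed.

(** * Flags of ideals and maximal sorted collections *)

Lemma sorted_pair_sym (n : nat) (I J : {set 'I_n}) : sorted_pair I J = sorted_pair J I.
Proof. by apply/sorted_pairP/sorted_pairP => -[]; auto. Qed.

Lemma sorted_pair_refl (n : nat) (I : {set 'I_n}) : sorted_pair I I.
Proof. by apply/sorted_pairP; left=> x _; rewrite leqnn leqnSn. Qed.

Lemma card_set_ord_le (n : nat) (S : {set 'I_n}) : #|S| <= n.
Proof. by have := max_card [in S]; rewrite card_ord. Qed.

Record flag (n : nat) (I : {set 'I_n}) (P : nat -> {set 'I_n}) : Prop := Flag {
  flag_ideal : forall j, j <= n -> ideal I (P j);
  flag_card : forall j, j <= n -> #|P j| = j;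
  flag_sub : forall j, j < n -> P j \subset P j.+1 }.

(** The index stops before [n] because [P n = setT] gives the same set [I] as [P 0]. *)
Definition flag_collection (n : nat) (I : {set 'I_n}) (P : nat -> {set 'I_n}) :
  {set {set 'I_n}} := [set shift I (P j) | j : 'I_n].

Lemma flag_mono (n : nat) (I : {set 'I_n}) (P : nat -> {set 'I_n}) (i j : nat) :
  flag I P -> i <= j <= n -> P i \subset P j.
Proof.
move=> flagP /andP[le_ij]; elim: j le_ij => [|j IHj].
  by rewrite leqn0 => /eqP->.
rewrite leq_eqVlt => /orP[/eqP-> //|le_ij] lt_j.
exact: subset_trans (IHj le_ij (ltnW lt_j)) (flag_sub flagP lt_j).
Qed.

Lemma flag0 (n : nat) (I : {set 'I_n}) (P : nat -> {set 'I_n}) : flag I P -> P 0 = set0.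
Proof. by move=> flagP; apply/eqP; rewrite -cards_eq0 (flag_card flagP). Qed.

Lemma flagT (n : nat) (I : {set 'I_n}) (P : nat -> {set 'I_n}) : flag I P -> P n = setT.
Proof.
move=> flagP; apply/eqP; rewrite eqEcard subsetT cardsT card_ord.
by rewrite (flag_card flagP (leqnn n)) leqnn.
Qed.

Lemma flag_neqT (n : nat) (I : {set 'I_n}) (P : nat -> {set 'I_n}) (j : 'I_n) :
  flag I P -> P j != setT.
Proof.
move=> flagP; apply: contraTneq (ltn_ord j) => eqPT; rewrite -leqNgt.
by rewrite -(flag_card flagP (ltnW (ltn_ord j))) eqPT cardsT card_ord.
Qed.

Lemma flag_step (n : nat) (I : {set 'I_n}) (P : nat -> {set 'I_n}) (j : nat) :
  flag I P -> j < n -> exists2 x, x \notin P j & P j.+1 = x |: P j.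
Proof.
move=> flagP lt_j.
have /cards1P[x def_x] : #|P j.+1 :\: P j| == 1.
  by rewrite cardsDS ?(flag_sub flagP) // !(flag_card flagP) ?subSnn // ltnW.
have : x \in P j.+1 :\: P j by rewrite def_x set11.
rewrite inE => /andP[Px PSx]; exists x => //; apply/eqP; rewrite eq_sym eqEcard.
rewrite subUset sub1set PSx (flag_sub flagP) // cardsU1 Px !(flag_card flagP) ?add1n ?leqnn //.
exact: ltnW.
Qed.

Lemma flag_comparable_eq (n : nat) (I Q : {set 'I_n.+1}) (P : nat -> {set 'I_n.+1}) :
  flag I P -> ideal I Q ->
  (forall j, j <= n.+1 -> (P j \subset Q) || (Q \subset P j)) ->
  Q = P #|Q|.
Proof.
move=> flagP idQ compQ; have le_Q := card_set_ord_le Q.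
by have /orP[sub|sub] := compQ _ le_Q; [apply/esym|]; apply/eqP;
   rewrite eqEcard sub (flag_card flagP) ?leqnn.
Qed.

Lemma mem_flag_collection (n : nat) (I : {set 'I_n.+1}) (P : nat -> {set 'I_n.+1})
    (j : nat) : flag I P -> j <= n.+1 -> shift I (P j) \in flag_collection I P.
Proof.
move=> flagP; rewrite leq_eqVlt => /orP[/eqP->|lt_j].
  by apply/imsetP; exists ord0; rewrite // (flagT flagP) (flag0 flagP) shiftT shift0.
by apply/imsetP; exists (Ordinal lt_j).
Qed.

(** A k-subset sorted with every member is sorted with [I], hence the shift of an ideal; being
    comparable with every term of the flag, this ideal is a term. *)
Lemma flag_collection_maximal (k n : nat) (I : {set 'I_n.+1}) (P : nat -> {set 'I_n.+1}) :
  #|I| = k -> flag I P -> maximal_sorted k (flag_collection I P).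
Proof.
move=> cardI flagP; have idP (j : 'I_n.+1) := flag_ideal flagP (ltnW (ltn_ord j)).
apply/maxsetP; split=> [|S /andP[/subsetP sub_S /forall_inP sortedS] sub_PS].
  apply/andP; split.
    by apply/subsetP=> _ /imsetP[j _ ->]; rewrite inE card_shift ?cardI.
  apply/forall_inP=> _ /imsetP[i _ ->]; apply/forall_inP=> _ /imsetP[j _ ->].
  rewrite sorted_shift //; case: (leqP i j) => [le_ij|/ltnW le_ji].
    by rewrite (flag_mono flagP) // le_ij ltnW.
  by rewrite orbC (flag_mono flagP) // le_ji ltnW.
apply/eqP; rewrite eqEsubset sub_PS andbT; apply/subsetP=> W SW.
have sortedW j : j <= n.+1 -> sorted_pair W (shift I (P j)).
  move=> le_j; apply: (forall_inP (sortedS W SW)).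
  by apply: (subsetP sub_PS); apply: mem_flag_collection.
have cardW : #|W| = #|I| by have := sub_S W SW; rewrite inE cardI => /eqP.
have := sortedW 0 isT; rewrite (flag0 flagP) shift0.
case/(sorted_pair_shift cardW) => Q idQ defW.
rewrite defW (@flag_comparable_eq _ I Q P) //; last first.
  move=> j le_j; rewrite orbC -(@sorted_shift _ I) ?(flag_ideal flagP) //.
  by rewrite -defW sortedW.
by apply: mem_flag_collection; rewrite // card_set_ord_le.
Qed.

(** [shift] is injective away from [setT] and cardinality fixes the index, so common members occur
    at equal positions only. *)
Lemma card_flag_collectionI (n : nat) (I : {set 'I_n.+1}) (P P' : nat -> {set 'I_n.+1}) :
  flag I P -> flag I P' ->
  #|flag_collection I P :&: flag_collection I P'| = #|[set j : 'I_n.+1 | P j == P' j]|.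
Proof.
move=> flagP flagP'.
have in_inj P1 (j : 'I_n.+1) : flag I P1 -> P1 j \in [pred Q | ideal I Q & Q != setT].
  by move=> flagP1; rewrite inE (flag_neqT _ flagP1) (flag_ideal flagP1) // ltnW.
have eq_flag P1 P2 (i j : 'I_n.+1) : flag I P1 -> flag I P2 ->
    shift I (P1 i) = shift I (P2 j) -> P1 i = P2 j /\ i = j.
  move=> flagP1 flagP2 /shift_inj eqP; have {}eqP := eqP (in_inj _ _ flagP1) (in_inj _ _ flagP2).
  split=> //; apply: val_inj; rewrite /= -(flag_card flagP1 (ltnW (ltn_ord i))).
  by rewrite -(flag_card flagP2 (ltnW (ltn_ord j))) eqP.
rewrite -(@card_in_imset _ _ (fun j : 'I_n.+1 => shift I (P j))); last first.
  by move=> i j _ _ /= /(eq_flag _ _ _ _ flagP flagP)[].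
apply: eq_card => W; rewrite inE; apply/andP/imsetP => [[]|[j]].
  case/imsetP=> i _ -> /imsetP[j _ /(eq_flag _ _ _ _ flagP flagP')[eqP eq_ij]].
  by exists i; rewrite // inE eqP eq_ij.
rewrite inE => /eqP eqP ->; split; last rewrite eqP; exact: imset_f.
Qed.

(** Let [Qp] be a smallest ideal of [S] strictly above [Q]. Every ideal of [S] lies inside [Q] or
    contains [Qp], so an ideal [y |: Q] inside [Qp] is sorted with all of [S] and belongs to [S] by
    maximality. *)
Lemma ideal_setU1_sorted (k n : nat) (I Q : {set 'I_n.+1}) (S : {set {set 'I_n.+1}}) :
  #|I| = k -> 0 < k <= n -> maximal_sorted k S -> I \in S ->
  ideal I Q -> shift I Q \in S -> Q != setT ->
  exists y, [/\ y \notin Q, ideal I (y |: Q) & shift I (y |: Q) \in S].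
Proof.
move=> cardI k_bounds /maxsetP[/andP[/subsetP sub_S /forall_inP sortedS] maxS] SI.
move=> idQ SQ QT.
pose C := [pred Q' : {set 'I_n.+1} | [&& ideal I Q', shift I Q' \in S & Q \proper Q']].
(* Some ideal above [Q] exists: the shift of [setT] is [I], a member of [S]. *)
have C_T : C setT by rewrite /= idealT shiftT SI properT QT.
have [/= Qp /and3P[idQp SQp ltQp] minQp] := @arg_minnP _ _ C (fun Q' => #|pred_of_set Q'|) C_T.
have [|y [Qpy Qy idyQ]] := ideal_extend _ idQ idQp ltQp; first by rewrite cardI.
exists y; split=> //.
have idQof W : W \in S -> exists2 Q', ideal I Q' & W = shift I Q'.
  move=> SW; apply: sorted_pair_shift; last by apply: (forall_inP (sortedS W SW)).
  by have := sub_S W SW; rewrite inE cardI => /eqP.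
have sorted_y W : W \in S -> sorted_pair (shift I (y |: Q)) W.
  move=> SW; have [Q' idQ' defW] := idQof W SW; rewrite defW sorted_shift //.
  have sortedQ Q1 : ideal I Q1 -> shift I Q1 \in S -> (Q' \subset Q1) || (Q1 \subset Q').
    move=> idQ1 SQ1; rewrite -(@sorted_shift _ I) // -defW.
    exact: (forall_inP (sortedS W SW)).
  have [sub_Q'Q|nsub_Q'Q] := boolP (Q' \subset Q).
    by rewrite (subset_trans sub_Q'Q) ?orbT // subsetUr.
  have := sortedQ Q idQ SQ; rewrite (negPf nsub_Q'Q) /= => sub_QQ'.
  suff sub_Qp : Qp \subset Q'.
    by rewrite subUset sub1set sub_QQ' (subsetP sub_Qp).
  have /orP[sub_Q'Qp|//] := sortedQ Qp idQp SQp.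
  have le_card : #|Qp| <= #|Q'| by apply: minQp; rewrite /= idQ' -defW SW properE sub_QQ'.
  by have /eqP-> : Q' == Qp by rewrite eqEcard sub_Q'Qp.
suff <- : shift I (y |: Q) |: S = S by rewrite setU11.
apply: maxS; last exact: subsetUr.
apply/andP; split.
  apply/subsetP=> W; rewrite in_setU1 => /predU1P[->|]; last exact: sub_S.
  by rewrite inE card_shift ?cardI.
apply/forall_inP=> V; rewrite in_setU1 => SV; apply/forall_inP=> W; rewrite in_setU1 => SW.
case/predU1P: SV SW => [->|SV] /predU1P[->|SW].
- exact: sorted_pair_refl.
- exact: sorted_y.
- by rewrite sorted_pair_sym sorted_y.
- exact: (forall_inP (sortedS V SV)).
Qed.

Lemma maximal_sorted_flag (k n : nat) (I : {set 'I_n.+1}) (S : {set {set 'I_n.+1}}) :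
  #|I| = k -> 0 < k <= n -> maximal_sorted k S -> I \in S ->
  exists2 P, flag I P & S = flag_collection I P.
Proof.
move=> cardI k_bounds maxS SI.
pose C := [pred Q : {set 'I_n.+1} | ideal I Q && (shift I Q \in S)].
pose next (Q : {set 'I_n.+1}) :=
  if [pick y | (y \notin Q) && C (y |: Q)] is Some y then y |: Q else Q.
pose P j := iter j next set0.
have nextP Q : C Q -> Q != setT -> [/\ C (next Q), #|next Q| = #|Q|.+1 & Q \subset next Q].
  case/andP=> idQ SQ QT; rewrite /next; case: pickP => [y /andP[Qy CyQ]|none].
    by rewrite cardsU1 Qy subsetUr.
  have [y [Qy idyQ SyQ]] := ideal_setU1_sorted cardI k_bounds maxS SI idQ SQ QT.
  by have := none y; rewrite /= Qy idyQ SyQ.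
have P_C j : j <= n.+1 -> C (P j) /\ #|P j| = j.
  elim: j => [_|j IHj lt_j]; first by rewrite /= ideal0 shift0 SI cards0.
  have [CP cardP] := IHj (ltnW lt_j).
  have [|CnP cardnP _] := nextP _ CP; last by rewrite cardP in cardnP.
  by apply: contraTneq lt_j => eqT; rewrite -cardP eqT cardsT card_ord ltnn.
have flagP : flag I P.
  split=> [j /P_C[/andP[]] //|j /P_C[] //|j lt_j].
  have [CP cardP] := P_C j (ltnW lt_j); have [|//] := nextP _ CP.
  by apply: contraTneq lt_j => eqT; rewrite -cardP eqT cardsT card_ord ltnn.
(* The flag was grown inside [S], and its collection is maximal, so the inclusion in [S] is an
   equality. *)
exists P => //; have /maxsetP[_ maxP] := flag_collection_maximal cardI flagP.
apply: maxP; first by case/maxsetP: maxS.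
by apply/subsetP=> _ /imsetP[j _ ->]; have [/andP[]] := P_C j (ltnW (ltn_ord j)).
Qed.

(* The step of the flag P leading to P j adds an element outside Q and the next step
   adds an element of Q. *)
Definition swappable (n : nat) (P : nat -> {set 'I_n}) (Q : {set 'I_n}) (j : nat) :=
  [&& 0 < j, j < n, P j :&: Q \subset P j.-1 & ~~ (P j.+1 :&: Q \subset P j)].

(* Exchanges those two steps at every swappable position selected by X. *)
Definition swap_flag (n : nat) (P : nat -> {set 'I_n}) (Q : {set 'I_n})
    (X : pred nat) (j : nat) : {set 'I_n} :=
  if X j && swappable P Q j then P j.-1 :|: (Q :&: P j.+1) else P j.

Lemma swappableP (n : nat) (I Q : {set 'I_n}) (P : nat -> {set 'I_n}) (j : nat) :
  flag I P -> swappable P Q j ->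
  exists a b, [/\ 0 < j < n, P j = a |: P j.-1, P j.+1 = b |: P j,
    a \notin P j.-1 & b \notin P j] /\
    [/\ a \notin Q, b \in Q & P j.-1 :|: (Q :&: P j.+1) = b |: P j.-1].
Proof.
move=> flagP; case: j => // j; case/and4P=> _ lt_j sub_j nsub_j.
have [a Pa defPa] := flag_step flagP (ltnW lt_j).
have [b Pb defPb] := flag_step flagP lt_j.
have Qa : a \notin Q.
  apply: contra Pa => Qa; apply: (subsetP sub_j).
  by rewrite inE Qa defPa setU11.
have Qb : b \in Q.
  apply: contraR nsub_j => Qb; apply/subsetP=> x; rewrite defPb !inE.
  by case: eqP => [->|_ /andP[]//]; rewrite (negPf Qb) andbF.
exists a, b; split; split=> //.
apply/setP=> x; rewrite !inE defPb !inE defPa !inE.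
have [->|_] /= := eqVneq x b; first by rewrite Qb orbT.
have [->|_] /= := eqVneq x a; first by rewrite (negPf Qa) orbF.
by case: (x \in P j); rewrite ?andbF.
Qed.

(** The new term P_(j-1) U (Q n P_(j+1)) is an ideal, as ideals are closed under union and
    intersection. *)
Lemma swap_flagP (n : nat) (I Q : {set 'I_n}) (P : nat -> {set 'I_n}) (X : pred nat) :
  flag I P -> ideal I Q -> flag I (swap_flag P Q X).
Proof.
move=> flagP idQ; split=> [j le_j|j le_j|j lt_j]; rewrite /swap_flag.
- case: ifP => [/andP[_ /and4P[_ lt_j _ _]]|_]; last exact: (flag_ideal flagP).
  apply: idealU; first by rewrite (flag_ideal flagP) // (leq_trans (leq_pred j)).
  by apply: idealI => //; apply: (flag_ideal flagP).
- case: ifP => [/andP[_ act_j]|_]; last exact: (flag_card flagP).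
  have [a [b [[/andP[j_gt0 _] defPa _ _ Pb] [_ _ ->]]]] := swappableP flagP act_j.
  rewrite cardsU1 (flag_card flagP) ?(leq_trans (leq_pred j)) //.
  by move: Pb; rewrite defPa !inE negb_or => /andP[_ ->]; rewrite add1n prednK.
- have sub_j := flag_sub flagP lt_j.
  case: ifP => [/andP[_ /and4P[j_gt0 _ _ _]]|_].
    have sub_j' : P j.-1 \subset P j.
      by apply: (flag_mono flagP); rewrite leq_pred ltnW.
    case: ifP => [/andP[_ /and4P[_ lt_Sj _ _]]|_].
      by rewrite /= setUSS // setIS // (flag_sub flagP).
    by rewrite subUset subIset ?subxx ?orbT // (subset_trans sub_j').
  by case: ifP => // _; rewrite /= subsetUl.
Qed.

Lemma swap_flag_eq (n : nat) (I Q : {set 'I_n}) (P : nat -> {set 'I_n})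
    (X Y : pred nat) (j : nat) : flag I P -> swappable P Q j ->
  (swap_flag P Q X j == swap_flag P Q Y j) = (X j == Y j).
Proof.
move=> flagP act_j; rewrite /swap_flag act_j !andbT.
have [a [b [[j_n defPa _ Pa Pb] [Qa Qb ->]]]] := swappableP flagP act_j.
have neq : (b |: P j.-1 == P j) = false.
  by apply/negbTE; apply: contraNneq Pb => <-; rewrite setU11.
by case: (X j) (Y j) => [] []; rewrite ?eqxx // eq_sym.
Qed.

(* Distinct swappable positions are never adjacent, so the exchanges commute and
   their subsets are the vertices of a cube. *)
Lemma swap_on_common_cube (k n : nat) (I Q : {set 'I_n.+1}) (P : nat -> {set 'I_n.+1})
    (j0 : 'I_n.+1) :
  #|I| = k -> flag I P -> ideal I Q -> swappable P Q j0 ->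
  on_common_cube k (flag_collection I P) (flag_collection I (swap_flag P Q predT)).
Proof.
move=> cardI flagP idQ act_j0.
pose M := [set j : 'I_n.+1 | swappable P Q j]; pose m := #|M|.
(* The cube has one coordinate per swappable position, telling whether to exchange there. *)
pose X (x : {ffun 'I_m -> bool}) (j : nat) :=
  [exists i : 'I_m, x i && (enum_val i == j :> nat)].
pose f x := flag_collection I (swap_flag P Q (X x)).
have X_enum x (i : 'I_m) : X x (enum_val i) = x i.
  apply/existsP/idP => [[i' /andP[xi' /eqP/val_inj/enum_val_inj <-]] //|xi].
  by exists i; rewrite xi eqxx.
have flagX x : flag I (swap_flag P Q (X x)) by exact: swap_flagP.
(* The flags of [x] and [y] differ exactly at the coordinates where [x] and [y] do; this count gives
   both the injectivity of [f] and the adjacencies. *)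
have card_fI x y : #|f x :&: f y| + #|[set i | x i != y i]| = n.+1.
  rewrite card_flag_collectionI // -(card_imset _ (@enum_val_inj _ [in M])).
  rewrite -[RHS]card_ord -(cardC (mem [set j : 'I_n.+1 |
    swap_flag P Q (X x) j == swap_flag P Q (X y) j])); congr (_ + _).
  apply: eq_card => j; rewrite !inE; apply/imsetP/idP => [[i]|neq_j].
    rewrite inE => neq_i ->; have := enum_valP i; rewrite inE => act_i.
    by rewrite (swap_flag_eq _ _ flagP act_i) !X_enum.
  have act_j : j \in M.
    by rewrite inE; apply: contraR neq_j; rewrite /swap_flag => /negPf->; rewrite !andbF.
  exists (enum_rank_in act_j j); last by rewrite enum_rankK_in.
  rewrite inE -!X_enum enum_rankK_in //.
  by move: neq_j act_j; rewrite inE => neq_j act_j; rewrite -(swap_flag_eq _ _ flagP act_j).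
have card_f x : #|f x| = n.+1.
  have := card_fI x x; rewrite setIid.
  by rewrite [X in _ + X](_ : _ = 0) ?addn0 //; apply: eq_card0 => i; rewrite !inE eqxx.
have f_inj : injective f.
  move=> x y eq_f; apply/ffunP=> i; apply/eqP/negPn/negP => neq_i.
  have := card_fI x y; rewrite eq_f setIid card_f => /eqP.
  rewrite -[X in _ == X]addn0 eqn_add2l cards_eq0 => /eqP/setP/(_ i).
  by rewrite !inE neq_i.
pose E S T := [exists x, exists y, [&& f x == S, f y == T & hypercube_adj x y]].
exists (f @: [set: {ffun 'I_m -> bool}]), E; split; first split.
- by move=> _ /imsetP[x _ ->]; apply: flag_collection_maximal.
- move=> S T /existsP[x /existsP[y /and3P[/eqP<- /eqP<- adj_xy]]].
  split; [exact: imset_f|exact: imset_f|].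
  rewrite /Gamma_adj !(flag_collection_maximal cardI) //=.
  have := card_fI x y; rewrite (eqP adj_xy) addn1 => -[->].
  rewrite eqxx andbT (inj_eq f_inj); apply: contraTneq adj_xy => ->.
  by rewrite /hypercube_adj (eq_card0 (A := [set i | y i != y i])) // => i; rewrite !inE eqxx.
- exists m, f; split=> // [|x y].
    by rewrite /m card_gt0; apply/set0Pn; exists j0; rewrite inE.
  apply/existsP/idP => [[x' /existsP[y' /and3P[/eqP/f_inj-> /eqP/f_inj->]]] //|adj_xy].
  by exists x; apply/existsP; exists y; rewrite !eqxx.
- apply/imsetP; exists [ffun=> false] => //; apply: eq_imset => j.
  congr shift; rewrite /swap_flag /X; case: existsP => //= -[i].
  by rewrite ffunE.
- apply/imsetP; exists [ffun=> true] => //; apply: eq_imset => j.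
  congr shift; rewrite /swap_flag; case: (boolP (swappable P Q j)) => [act_j|_].
    have Mj : j \in M by rewrite inE.
    suff -> : X [ffun=> true] j by [].
    by rewrite -(enum_rankK_in Mj Mj) X_enum ffunE.
  by rewrite !andbF.
Qed.

(** * Cube walks and levels *)

Definition incomparable (n : nat) (A B : {set 'I_n}) :=
  ~~ (A \subset B) && ~~ (B \subset A).

Definition sym_dist (n : nat) (A B : {set 'I_n}) := #|A :\: B| + #|B :\: A|.

Lemma sym_dist_gt1 (n : nat) (A B : {set 'I_n}) : incomparable A B -> 1 < sym_dist A B.
Proof.
rewrite /incomparable -!setD_eq0 -!card_gt0 => /andP[gt0 gt0'].
by rewrite /sym_dist -addn1 leq_add.
Qed.

Lemma incomparable_flag_bounds (n : nat) (I Q : {set 'I_n}) (P : nat -> {set 'I_n})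
    (p : nat) : flag I P -> p <= n -> incomparable (P p) Q -> 0 < p < n.
Proof.
move=> flagP le_p /andP[nsub nsub']; apply/andP; split.
  by case: p nsub {le_p nsub'} => //; rewrite (flag0 flagP) sub0set.
rewrite ltn_neqAle le_p andbT; apply: contraNneq nsub' => ->.
by rewrite (flagT flagP) subsetT.
Qed.

(** If [p] was exchanged, [P p] itself is farther from [Q]. Otherwise the steps around [p] do not
    read 01: going back over a 1 or forward over a 0 gives a farther term, still incomparable with
    [Q]. *)
Lemma swap_flag_dist (n : nat) (I Q : {set 'I_n}) (P : nat -> {set 'I_n}) (p : nat) :
  flag I P -> ideal I Q -> p <= n -> incomparable (swap_flag P Q predT p) Q ->
  exists p', [/\ p' <= n, incomparable (P p') Q
    & sym_dist (swap_flag P Q predT p) Q < sym_dist (P p') Q].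
Proof.
move=> flagP idQ le_p inc.
have /andP[p_gt0 lt_p] :=
  incomparable_flag_bounds (swap_flagP predT flagP idQ) le_p inc.
move: inc; rewrite /swap_flag /=; case: ifP => [act_p _|nact_p /andP[nsub nsub']].
  have [a [b [[_ defPa defPb Pa Pb] [Qa Qb ->]]]] := swappableP flagP act_p.
  exists p; split=> //.
    apply/andP; split; apply/subsetPn; last by exists b.
    by exists a; rewrite // defPa setU11.
  rewrite /sym_dist -addSn leq_add //.
    apply/proper_card/properP; split.
      apply/subsetP=> x; rewrite defPa !inE; case: eqP => [->|_ /= /andP[-> ->]].
        by rewrite Qb.
      by rewrite orbT.
    exists a; first by rewrite inE Qa defPa setU11.
    by rewrite !inE Qa (negPf Pa) orbF; apply: contraNneq Qa => ->.
  apply/subset_leq_card/subsetP=> x; rewrite !inE defPa !inE => /andP[+ Qx].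
  by rewrite Qx andbT !negb_or => /andP[_ ->]; rewrite andbT; apply: contraNneq Qa => <-.
case: p p_gt0 le_p lt_p nact_p nsub nsub' => // p _ le_p lt_p nact_p nsub nsub'.
have [a Pa defPa] := flag_step flagP le_p.
have [b Pb defPb] := flag_step flagP lt_p.
have [Qa|Qa] := boolP (a \in Q).
  have sub : P p \subset P p.+1 by rewrite defPa subsetUr.
  exists p; split; first exact: ltnW.
    rewrite /incomparable; apply/andP; split; last first.
      by apply: contra nsub' => /subset_trans; apply.
    by apply: contra nsub => sub_Q; rewrite defPa subUset sub1set Qa.
  rewrite /sym_dist -addnS leq_add //.
    apply/subset_leq_card/subsetP=> x; rewrite defPa !inE => /andP[Qx /predU1P[eq_xa|Px]].
      by rewrite eq_xa Qa in Qx.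
    by rewrite Qx.
  apply/proper_card/properP; split; first exact: setDS.
  by exists a; rewrite !inE ?Qa ?Pa // defPa setU11.
(* The step into this term is a 0, and the position is not swappable, so the step out is a 0 as
   well. *)
have Qb : b \notin Q.
  apply/negP=> Qb; move/negP: nact_p; apply; rewrite /swappable /= lt_p /=.
  apply/andP; split; last first.
    by apply/subsetPn; exists b; rewrite // !inE defPb setU11.
  apply/subsetP=> x; rewrite defPa !inE => /andP[/predU1P[->|//]].
  by rewrite (negPf Qa).
have sub : P p.+1 \subset P p.+2 by rewrite defPb subsetUr.
exists p.+2; split=> //.
  rewrite /incomparable; apply/andP; split.
    by apply: contra nsub => /(subset_trans sub).
  apply: contra nsub' => /subsetP sub_Q; apply/subsetP=> x Qx.
  have := sub_Q x Qx; rewrite defPb in_setU1 => /predU1P[eq_xb|//].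
  by rewrite -eq_xb Qx in Qb.
rewrite /sym_dist -addSn leq_add //.
  apply/proper_card/properP; split; first exact: setSD.
  by exists b; rewrite !inE ?Qb ?(negPf Pb) // defPb setU11.
apply/subset_leq_card/subsetP=> x; rewrite [P p.+2]defPb in_setD in_setD in_setU1 => /andP[Px Qx].
by rewrite negb_or Px Qx !andbT; apply: contraNneq Qb => <-.
Qed.

(** * Walks obtained by repeated swapping *)

Lemma cube_walk_cons (k n : nat) (S S' T : {set {set 'I_n}}) (D : nat) :
  maximal_sorted k S -> on_common_cube k S S' -> cube_walk k S' T D ->
  cube_walk k S T D.+1.
Proof.
move=> maxS cubeS [I_ [I0 ID maxI cubeI]].
exists (fun i => if i is i'.+1 then I_ i' else S); split=> // [[|i]|[|i]] //.
- exact: maxI.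
- by rewrite I0.
- exact: cubeI.
Qed.

(** Each simultaneous swap costs at most one cube and lowers the bound by one. Incomparable sets are
    at distance at least 2, so for [m = 0] the ideal [Q] is comparable with the whole flag and is
    one of its terms. *)
Lemma cube_walk_flag (k n m : nat) (I Q : {set 'I_n.+1}) (P : nat -> {set 'I_n.+1}) :
  #|I| = k -> flag I P -> ideal I Q ->
  (forall p, p <= n.+1 -> incomparable (P p) Q -> sym_dist (P p) Q <= m.+1) ->
  exists D T, [/\ D <= m, maximal_sorted k T, shift I Q \in T
    & cube_walk k (flag_collection I P) T D].
Proof.
move=> cardI + idQ; elim: m P => [|m IHm] P flagP dist_m.
  have maxP := flag_collection_maximal cardI flagP.
  exists 0, (flag_collection I P); split=> //; last by exists (fun=> flag_collection I P); split.
  rewrite (@flag_comparable_eq _ I Q P) ?mem_flag_collection ?card_set_ord_le // => j le_j.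
  apply/negPn/negP; rewrite negb_or => inc.
  by have := dist_m j le_j inc; rewrite leqNgt sym_dist_gt1.
pose P' := swap_flag P Q predT; have flagP' : flag I P' by exact: swap_flagP.
have [|D [T [le_D maxT T_Q walk]]] := IHm P' flagP'.
  move=> p le_p inc; have [p' [le_p' inc' lt_dist]] := swap_flag_dist flagP idQ le_p inc.
  by rewrite -ltnS (leq_trans lt_dist) // dist_m.
have [/existsP[j act_j]|/existsPn nact] := boolP [exists j : 'I_n.+1, swappable P Q j].
  exists D.+1, T; split=> //; apply: cube_walk_cons walk.
    exact: flag_collection_maximal.
  exact: swap_on_common_cube act_j.
(* Without swappable positions the swap changes nothing, so the walk from [P'] already starts at
   [P]. *)
exists D, T; split=> //; first exact: leqW.
suff -> : flag_collection I P = flag_collection I P' by [].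
by apply: eq_imset => j; rewrite /P' /swap_flag (negPf (nact j)).
Qed.

Lemma cube_d_exists (k n : nat) (S T : {set {set 'I_n}}) (D : nat) :
  cube_walk k S T D -> exists2 d, d <= D & cube_d k S T d.
Proof.
move=> walkD; have exD : exists d, `[< cube_walk k S T d >] by exists D; apply/asboolP.
case: (ex_minnP exD) => d /asboolP walk_d min_d; exists d; first exact/min_d/asboolP.
by split=> // d' /asboolP; apply: min_d.
Qed.

(** Take for [x] the element added by the first term [P j.+1] containing [Q]. Then
    [Q :\ x = Q :&: P j] is a proper part of [P j]; in the supermodular inequality the minors of the
    two flag terms are equal and cancel. *)
Lemma Delta_shift_lt_setD1 (R : realType) (k n : nat) (A : 'M[R]_(k, n.+1))
    (I Q : {set 'I_n.+1}) (P : nat -> {set 'I_n.+1}) (p : nat) :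
  Gr_pos A -> #|I| = k -> 0 < k <= n -> flag I P -> ideal I Q ->
  (forall j, j <= n.+1 -> Delta A (shift I (P j)) = Delta A I) ->
  p <= n.+1 -> incomparable (P p) Q ->
  exists x, [/\ x \in Q :\: P p, ideal I (Q :\ x)
    & (Delta A (shift I Q) < Delta A (shift I (Q :\ x)))%R].
Proof.
move=> posA cardI k_bounds flagP idQ eq_P le_p /andP[nsub nsub'].
have exj : exists j, (j <= n.+1) && (Q \subset P j).
  by exists n.+1; rewrite leqnn (flagT flagP) subsetT.
case: (ex_minnP exj) => -[|j] /andP[lt_j sub_j] min_j.
  by case/negP: nsub'; apply: subset_trans sub_j _; rewrite (flag0 flagP) sub0set.
have [x Px defPx] := flag_step flagP lt_j.
have nsub_j : ~~ (Q \subset P j).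
  by apply/negP => sub_jj; have := min_j j; rewrite sub_jj ltnW // ltnn; apply/implyP.
have le_pj : p <= j.
  rewrite leqNgt; apply: contra nsub' => lt_jp.
  by apply: subset_trans sub_j (flag_mono flagP _); rewrite lt_jp.
have sub_pj : P p \subset P j by rewrite (flag_mono flagP) // le_pj ltnW.
have Qx : x \in Q.
  apply: contraR nsub_j => Qx; apply/subsetP=> y Qy; have := subsetP sub_j y Qy.
  by rewrite defPx in_setU1 => /predU1P[eq_yx|//]; rewrite -eq_yx Qy in Qx.
have defQ' : Q :\ x = Q :&: P j.
  apply/setP=> y; rewrite !inE andbC; have [Qy|//] := boolP (y \in Q).
  have := subsetP sub_j y Qy; rewrite defPx in_setU1 /=.
  by case: eqP => [->|_] /= => [_|->] //; rewrite (negPf Px).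
exists x; rewrite inE Qx andbT; split.
- by apply: contra Px; apply: (subsetP sub_pj).
- by rewrite defQ'; apply: idealI => //; apply: (flag_ideal flagP); apply: ltnW.
have idQ' : ideal I (Q :\ x).
  by rewrite defQ'; apply: idealI => //; apply: (flag_ideal flagP); apply: ltnW.
have prop : Q :\ x \proper P j.
  rewrite defQ' properE subsetIr subsetI subxx andbT.
  by apply: contra nsub; apply: subset_trans.
have := @Delta_shift_supermodular R k n A I (Q :\ x) (P j) x posA cardI k_bounds idQ'.
rewrite setD1K // => /(_ (flag_ideal flagP (ltnW lt_j)) idQ Px prop).
rewrite -defPx !eq_P //; last exact: ltnW.
rewrite ltr_pM2r // -(eq_P 0) // .
by apply: (Delta_shift_gt0 posA cardI); apply: (flag_ideal flagP).
Qed.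

(** Dual to [Delta_shift_lt_setD1]: [x] is added by the first term of the flag not contained in [Q],
    and supermodularity compares the preceding term with [Q]. *)
Lemma Delta_shift_lt_setU1 (R : realType) (k n : nat) (A : 'M[R]_(k, n.+1))
    (I Q : {set 'I_n.+1}) (P : nat -> {set 'I_n.+1}) (p : nat) :
  Gr_pos A -> #|I| = k -> 0 < k <= n -> flag I P -> ideal I Q ->
  (forall j, j <= n.+1 -> Delta A (shift I (P j)) = Delta A I) ->
  p <= n.+1 -> incomparable (P p) Q ->
  exists x, [/\ x \in P p :\: Q, ideal I (x |: Q)
    & (Delta A (shift I Q) < Delta A (shift I (x |: Q)))%R].
Proof.
move=> posA cardI k_bounds flagP idQ eq_P le_p /andP[nsub nsub'].
case: (ex_minnP (ex_intro (fun j => ~~ (P j \subset Q)) p nsub)) => -[|j] nsub_j min_j.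
  by rewrite (flag0 flagP) sub0set in nsub_j.
have lt_jp : j < p by exact: min_j.
have lt_j : j < n.+1 by exact: leq_trans lt_jp le_p.
have sub_j : P j \subset Q.
  by apply/negPn/negP => nsub_jj; have := min_j j nsub_jj; rewrite ltnn.
have [x Px defPx] := flag_step flagP lt_j.
have Qx : x \notin Q by apply: contra nsub_j => Qx; rewrite defPx subUset sub1set Qx.
have sub_jp : P j.+1 \subset P p by rewrite (flag_mono flagP) // lt_jp.
have idxQ : ideal I (x |: Q).
  rewrite -(setUidPr sub_j) setUA -defPx; apply: idealU => //.
  exact: (flag_ideal flagP).
exists x; rewrite inE Qx; split=> //.
  by apply: (subsetP sub_jp); rewrite defPx setU11.
have prop : P j \proper Q.
  rewrite properE sub_j; apply: contra nsub' => /subset_trans; apply.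
  by rewrite (flag_mono flagP) // le_p ltnW.
have := @Delta_shift_supermodular R k n A I (P j) Q x posA cardI k_bounds.
rewrite -defPx => /(_ (flag_ideal flagP (ltnW lt_j)) idQ (flag_ideal flagP lt_j) Qx prop).
rewrite !eq_P //; last exact: ltnW.
rewrite ltr_pM2l // -(eq_P 0) //.
by apply: (Delta_shift_gt0 posA cardI); apply: (flag_ideal flagP).
Qed.

(* Each removal or addition brings [Q] one step closer to [P p] and raises its
   minor, hence its level in the arrangement. *)
Lemma level_sym_dist (R : realType) (k n : nat) (A : 'M[R]_(k, n.+1))
    (I Q : {set 'I_n.+1}) (P : nat -> {set 'I_n.+1}) (p top i : nat)
    (level : nat -> {set 'I_n.+1} -> Prop) :
  Gr_pos A -> #|I| = k -> 0 < k <= n -> flag I P ->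
  (forall j, j <= n.+1 -> Delta A (shift I (P j)) = Delta A I) ->
  (forall V, V \in ksubsets k n.+1 -> exists2 j, j <= top & level j V) ->
  (forall i j V W, level i V -> level j W -> (Delta A V < Delta A W)%R -> i < j) ->
  ideal I Q -> p <= n.+1 -> incomparable (P p) Q -> level i (shift I Q) ->
  i + sym_dist (P p) Q <= top.+1.
Proof.
move=> posA cardI k_bounds flagP eq_P level_ex level_lt + le_p.
have [m] := ubnP (sym_dist (P p) Q); elim: m => // m IHm in Q i *.
move=> le_m idQ inc level_i.
have level_up Q' : ideal I Q' -> (Delta A (shift I Q) < Delta A (shift I Q'))%R ->
    exists j, [/\ j <= top, level j (shift I Q') & i < j].
  move=> idQ' lt_QQ'; have [|j le_j level_j] := level_ex (shift I Q').
    by rewrite inE card_shift // cardI.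
  by exists j; split=> //; apply: level_lt level_i level_j lt_QQ'.
have IHQ Q' : ideal I Q' -> (Delta A (shift I Q) < Delta A (shift I Q'))%R ->
    sym_dist (P p) Q = (sym_dist (P p) Q').+1 -> incomparable (P p) Q' ->
    i + sym_dist (P p) Q <= top.+1.
  move=> idQ' lt_QQ' dist_Q' inc'; have [j [_ level_j lt_ij]] := level_up Q' idQ' lt_QQ'.
  have := IHm Q' j _ idQ' inc' level_j; rewrite dist_Q' in le_m * => /(_ le_m).
  by apply: leq_trans; rewrite addnS -addSn leq_add2r.
have [x [/setDP[Qx Px] idQx lt_x]] :=
  Delta_shift_lt_setD1 posA cardI k_bounds flagP idQ eq_P le_p inc.
have [y [/setDP[Py Qy] idQy lt_y]] :=
  Delta_shift_lt_setU1 posA cardI k_bounds flagP idQ eq_P le_p inc.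
have eqDx1 : P p :\: (Q :\ x) = P p :\: Q.
  by apply/setP=> z; rewrite !inE; case: eqP => [->|]; rewrite ?(negPf Px) ?andbF.
have eqDx2 : (Q :\ x) :\: P p = (Q :\: P p) :\ x by rewrite setDDl setUC -setDDl.
have eqDy1 : (y |: Q) :\: P p = Q :\: P p.
  by apply/setP=> z; rewrite !inE; case: eqP => [->|]; rewrite ?Py.
have eqDy2 : P p :\: (y |: Q) = (P p :\: Q) :\ y by rewrite setUC setDDl.
have cardx : #|Q :\: P p| = #|(Q :\: P p) :\ x|.+1 by rewrite (cardsD1 x) inE Px Qx.
have cardy : #|P p :\: Q| = #|(P p :\: Q) :\ y|.+1 by rewrite (cardsD1 y) inE Py Qy.
move: (inc); rewrite /incomparable -!setD_eq0 => /andP[nz1 nz2].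
(* Removing [x] keeps incomparability unless [x] is the only element of [Q :\: P p]; likewise below
   for adding [y]. *)
have [eq0x|neq0x] := eqVneq #|(Q :\: P p) :\ x| 0; last first.
  apply: (IHQ _ idQx lt_x); first by rewrite /sym_dist eqDx1 eqDx2 cardx addnS.
  by rewrite /incomparable -!setD_eq0 eqDx1 eqDx2 nz1 -cards_eq0.
have [eq0y|neq0y] := eqVneq #|(P p :\: Q) :\ y| 0; last first.
  apply: (IHQ _ idQy lt_y); first by rewrite /sym_dist eqDy1 eqDy2 cardy addSn.
  by rewrite /incomparable -!setD_eq0 eqDy1 eqDy2 nz2 -cards_eq0 neq0y.
(* Both differences are singletons, so the distance is 2 and a single rise of level suffices. *)
have [j [le_j _ lt_ij]] := level_up _ idQx lt_x.
by rewrite /sym_dist cardx cardy eq0x eq0y addn2 ltnS; apply: leq_trans lt_ij le_j.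
Qed.

(** * Comparison of the level bound with the cube distance *)

Theorem theorem5p5 (R : realType) (k n : nat) (hk : (1 <= k)%N) (hkn : (k <= n)%N)
    (J : {set {set 'I_n}})
    (hJ : maximal_arrangement_of_largest_minors R k J)
    (W : {set 'I_n}) (hW : W \in ksubsets k n) (hWJ : W \notin J)
    (t : nat) (ht : cube_d_to k J W t)
    (hsorted : exists2 I, I \in J & sorted_pair W I) :
  ge_largest_minor R k (t + 1)%N J W.
Proof.
case: n hkn J hJ W hW hWJ ht hsorted => [|n] hkn J _ W hW hWJ.
  by move: (leq_trans hk hkn).
case=> -[T [_ _ [[I_ [I0 _ maxI _]] _]]] min_t [I JI sortedWI].
(* [J] is the first vertex of the walk realising the distance. *)
have maxJ : maximal_sorted k J by rewrite -I0; apply: maxI.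
have sub_J V : V \in J -> V \in ksubsets k n.+1.
  by case/maxsetP: maxJ => /andP[/subsetP sub _] _; apply: sub.
have /eqP cardI : #|I| == k by have := sub_J I JI; rewrite inE.
have /eqP cardW : #|W| == k by move: hW; rewrite inE.
(* For [k = n.+1] there is only one k-subset, which would put [W] in [J]. *)
have k_bounds : 0 < k <= n.
  rewrite hk -ltnS ltn_neqAle hkn andbT; apply: contraNneq hWJ => eq_kn.
  have eqT (V : {set 'I_n.+1}) : #|V| = k -> V = [set: 'I_n.+1].
    by move=> cardV; apply/eqP; rewrite eqEcard subsetT cardsT card_ord cardV eq_kn /=.
  by rewrite (eqT W cardW) -(eqT I cardI).
have [Q idQ defW] := sorted_pair_shift (etrans cardW (esym cardI)) sortedWI.
have [P flagP defJ] := maximal_sorted_flag cardI k_bounds maxJ JI.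
move=> U [[_ _ /and3P[/eqP coverU _ _]] [A posA Delta_U]] topU i top_i le_i.
apply/negP => W_i.
have eq_P j : j <= n.+1 -> Delta A (shift I (P j)) = Delta A I.
  move=> le_j; have P_top : shift I (P j) \in nth set0 U (top_index U).
    by rewrite topU defJ mem_flag_collection.
  have I_top : I \in nth set0 U (top_index U) by rewrite topU.
  by have [/(_ erefl)] := Delta_U _ _ _ _ P_top I_top.
have level_ex V : V \in ksubsets k n.+1 ->
    exists2 j, j <= top_index U & V \in nth set0 U j.
  rewrite -coverU => /bigcupP[B]; rewrite inE => UB VB.
  (* The successor accounts for the empty block U_0 at the head. *)
  exists (index B (behead U)).+1; last by rewrite -nth_behead nth_index.
  by rewrite /top_index -size_behead index_mem.
have level_lt j j' V V' : V \in nth set0 U j -> V' \in nth set0 U j' ->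
    (Delta A V < Delta A V')%R -> j < j'.
  move=> V_j V'_j' lt_VV'; rewrite ltnNge leq_eqVlt; apply/negP => /orP[/eqP eq_j|lt_j].
    by have [/(_ (esym eq_j)) eqD _] := Delta_U _ _ _ _ V_j V'_j'; rewrite eqD ltxx in lt_VV'.
  have [_ /(_ lt_j) lt_V'V] := Delta_U _ _ _ _ V'_j' V_j.
  by have := lt_trans lt_VV' lt_V'V; rewrite ltxx.
rewrite defW in W_i hW hWJ min_t.
(* With l = [top_index U], the level bound gives distances at most l - i + 1, so l - i cubes
   suffice. Hence t <= l - i, against [top_i], which says l + 2 <= i + t + 1. *)
have [|D [T' [le_D maxT' T'W walk]]] :=
    @cube_walk_flag k n (top_index U - i) I Q P cardI flagP idQ.
  move=> p le_p inc; rewrite -subSn // leq_subRL ?(leqW le_i) //.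
  exact: (@level_sym_dist R k n A I Q P p _ i
           (fun j V => V \in nth set0 U j) posA cardI k_bounds flagP).
have [d le_d cube_dT'] := cube_d_exists walk.
have le_td : t <= d by apply: min_t; exists T'; split=> //; rewrite defJ.
by have := leq_trans le_td (leq_trans le_d le_D); lia.
Qed.
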